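(* Let $m\geq2$, let $\lambda\in\mathbb{N}^m$ be a partition, and let $\ell\geq d(\lambda)$ be a positive integer. Then for generic $z=(z_1,\ldots,z_{|\lambda|})$, the functions $Q(\mathcal{U})$, for all different choices of admissible partitionings $\mathcal{U}$ of $\{1,\ldots,|\lambda|\}$, span the space of conformal blocks $CB^\ell_z(\lambda)$.
   Context: $\mathbb{N}=\{0,1,2,\ldots\}$. For a partition $\lambda=(\lambda_1\geq\cdots\geq\lambda_m)\in\mathbb{N}^m$, $m\ge 2$, write $|\lambda|=\sum_i\lambda_i$ and $d(\lambda)=\lambda_1-\lambda_m$. Tuples $z=(z_1,\ldots,z_{|\lambda|})$ consist of pairwise distinct complex numbers; ''generic $z$'' means all such $z$ in some nonempty Zariski open subset. Let $V^{\otimes|\lambda|}$ denote the space of complex polynomials in the variables $y^{(j)}_a$ ($1\le j\le m$, $1\le a\le|\lambda|$) that are homogeneous of degree 1 in the $m$-tuple $y^{(1)}_a,\ldots,y^{(m)}_a$ for each $a$. Put $$e_{i,j}=\sum_{a=1}^{|\lambda|}y^{(i)}_a\frac{\partial}{\partial y^{(j)}_a},\qquad e^{z}_{i,j}=\sum_{a=1}^{|\lambda|}z_a\,y^{(i)}_a\frac{\partial}{\partial y^{(j)}_a}.$$ Let $SV(\lambda)=\{p\in V^{\otimes|\lambda|} : e_{i,j}p=0 \text{ for } 1\le i<j\le m,\ e_{i,i}p=\lambda_i p \text{ for } 1\le i\le m\}$, and for a positive integer $\ell\geq d(\lambda)$ define the space of conformal blocks at level $\ell$, $$CB^\ell_z(\lambda)=\{p\in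 SV(\lambda) : (e^z_{1,m})^{\ell-d(\lambda)+1}p=0\}.$$ For finite index sets $I,J$, let $R(z_I|z_J)=\prod_{a\in I}\prod_{b\in J}(z_a-z_b)$ and $R(z_{I_1}|\ldots|z_{I_m})=\prod_{i<j}R(z_{I_i}|z_{I_j})$. For a partition $\mu\in\mathbb{N}^m$ define $$P_z(\mu)=\sum_{(I_1,\ldots,I_m)}\frac{\prod_{j=1}^m \prod_{a\in I_j}y^{(j)}_a}{R(z_{I_1}|\ldots|z_{I_m})},$$ the sum over ordered tuples of pairwise disjoint sets with $\bigcup_jI_j=\{1,\ldots,|\mu|\}$, $|I_j|=\mu_j$. For pairwise different integers $k_1,\ldots,k_{|\mu|}$, let $P^{(k_1,\ldots,k_{|\mu|})}(\mu)$ be obtained from $P_z(\mu)$ by substituting $y^{(j)}_{k_a}$ for $y^{(j)}_a$ and $z_{k_a}$ for $z_a$ for all $j,a$. Put formally $\lambda_0=\ell+\lambda_m$. A partitioning $\mathcal{U}=\{U_1,\ldots,U_\ell\}$ of $\{1,\ldots,|\lambda|\}$ into $\ell$ (possibly empty) subsets is called admissible if for every $j=0,\ldots,m-1$ exactly $\lambda_j-\lambda_{j+1}$ of the sets $U_i$ satisfy $|U_i|\equiv j \pmod m$. Each $U_j$ is regarded as an ordered set with the natural order of integers. Let $\mu^{(j)}\in\mathbb{N}^m$ be the unique partition with $|\mu^{(j)}|=|U_j|$ and $d(\mu^{(j)})\in\{0,1\}$. Define $$Q(\mathcal{U})=\prod_{j=1}^{\ell}P^{(U_j)}(\mu^{(j)}).$$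 *)

(* Defs.v *)
From HB Require Import structures.
From mathcomp Require Import all_boot all_order all_algebra.
From mathcomp Require Import mpoly complex reals.

Set Implicit Arguments.
Unset Strict Implicit.
Unset Printing Implicit Defensive.

Import GRing.Theory.
Local Open Scope ring_scope.

(* A partition in N^m is [lam : m.-tuple nat] with [sorted geq lam]; [|lam|] is *)
(* [sumn lam] and, indices being shifted to start at 0, lambda_1 and lambda_m   *)
(* are [nth 0 lam 0] and [nth 0 lam m.-1].                                      *)
Definition spread (m : nat) (lam : m.-tuple nat) : nat :=
  (nth 0 lam 0 - nth 0 lam m.-1)%N.

(* [ext_part ell lam j] is lambda_j with its original index, where lambda_0 is  *)
(* ell + lambda_m.                                                              *)
Definition ext_part (m ell : nat) (lam : m.-tuple nat) (j : nat) : nat :=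
  if j is j'.+1 then nth 0%N lam j' else (ell + nth 0 lam m.-1)%N.

Section Blocks.

Variables (C : fieldType) (m n : nat).

Implicit Types (z : 'I_n -> C) (p : {mpoly C[m * n]}).

(* The variable y^(j)_a. *)
Definition yvar (j : 'I_m) (a : 'I_n) : {mpoly C[m * n]} :=
  'X_(mxvec_index j a).

(* Membership in V^{(x) n}: in every monomial of p, for every a, the total      *)
(* degree in y^(1)_a, ..., y^(m)_a is 1.                                        *)
Definition multilinear p : Prop :=
  forall mon, mon \in msupp p ->
  forall a : 'I_n, (\sum_(j < m) mon (mxvec_index j a))%N = 1%N.

Definition e_op (i j : 'I_m) p : {mpoly C[m * n]} :=
  \sum_(a < n) yvar i a * p^`M(mxvec_index j a).

Definition ez_op z (i j : 'I_m) p : {mpoly C[m * n]} :=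
  \sum_(a < n) z a *: (yvar i a * p^`M(mxvec_index j a)).

Definition SV (lam : m.-tuple nat) p : Prop :=
  [/\ multilinear p,
      forall i j : 'I_m, (i < j)%N -> e_op i j p = 0
    & forall i : 'I_m, e_op i i p = (tnth lam i)%:R *: p].

(* The two equations on i and j select the first and the last index, so that    *)
(* ez_op z i j is e^z_{1,m}.                                                    *)
Definition CB z (ell : nat) (lam : m.-tuple nat) p : Prop :=
  SV lam p /\
  forall i j : 'I_m, i = 0%N :> nat -> j = m.-1 :> nat ->
    iter (ell - spread lam).+1 (ez_op z i j) p = 0.

End Blocks.

(* Ordered tuples of k pairwise disjoint, possibly empty, sets covering 'I_n.   *)
Definition set_partition (k n : nat) (I : {ffun 'I_k -> {set 'I_n}}) : bool :=
  [forall i, forall j, (i != j) ==> [disjoint I i & I j]] &&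
  (\bigcup_i I i == [set: 'I_n]).

Section Functions.

Variable C : fieldType.

Definition R2 (r : nat) (z : 'I_r -> C) (I J : {set 'I_r}) : C :=
  \prod_(a in I) \prod_(b in J) (z a - z b).

Definition Rmul (m r : nat) (z : 'I_r -> C) (I : {ffun 'I_m -> {set 'I_r}}) : C :=
  \prod_(i < m) \prod_(j < m | (i < j)%N) R2 z (I i) (I j).

(* P(mu), with r = |mu|, as a function of the quantities substituted for the    *)
(* y^(j)_a and the z_a.                                                         *)
Definition Pfun (A : comAlgType C) (m r : nat) (y : 'I_m -> 'I_r -> A)
    (z : 'I_r -> C) (mu : m.-tuple nat) : A :=
  \sum_(I : {ffun 'I_m -> {set 'I_r}} |
          set_partition I && [forall j, #|I j| == tnth mu j])
    (Rmul z I)^-1 *: \prod_(j < m) \prod_(a in I j) y j a.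

(* P^{(U)}(mu), with r = |U|; enum_val lists the elements of U increasingly.    *)
Definition Pset (m n : nat) (z : 'I_n -> C) (U : {set 'I_n})
    (mu : m.-tuple nat) : {mpoly C[m * n]} :=
  Pfun (fun (j : 'I_m) (a : 'I_#|U|) => yvar C j (enum_val a))
       (fun a : 'I_#|U| => z (enum_val a)) mu.

End Functions.

(* The unique partition mu in N^m with |mu| = r and d(mu) in {0, 1}; see        *)
(* [balancedP].                                                                 *)
Definition balanced (m r : nat) : m.-tuple nat :=
  [tuple (r %/ m + (i < r %% m))%N | i < m].

Lemma balancedP (m r : nat) (mu : m.-tuple nat) : (0 < m)%N ->
  [/\ sorted geq mu, sumn mu = r & (spread mu <= 1)%N] <-> mu = balanced m r.
Proof.
move=> m_gt0.
have nthB i : (i < m)%N ->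
    nth 0%N (balanced m r) i = (r %/ m + (i < r %% m))%N.
  by move=> lt_im; rewrite -(tnth_nth 0%N _ (Ordinal lt_im)) tnth_mktuple.
have sumnE_nth (t : m.-tuple nat) : sumn t = (\sum_(i < m) nth 0%N t i)%N.
  by rewrite sumnE (big_nth 0%N) size_tuple big_mkord.
have sum_lt k : (\sum_(i < m) (i < k) = minn k m)%N.
  elim: m {m_gt0 mu nthB sumnE_nth} => [|m IHm]; first by rewrite big_ord0 minn0.
  rewrite big_ord_recr IHm /=; case: (ltnP m k) => [lt_mk | le_km].
    by rewrite !(minn_idPr _) // ?addn1 // ltnW.
  by rewrite !(minn_idPl _) ?addn0 // ltnW.
have geq_tr : transitive geq by move=> a b c ba ac; apply: leq_trans ac ba.
have lt_pm : (m.-1 < m)%N by rewrite prednK.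
split=> [[mu_dec mu_sum] | ->]; last first.
  split.
  - apply/(sortedP 0%N) => i; rewrite size_tuple => lt_im.
    rewrite !nthB ?(ltnW lt_im) // /geq /= leq_add2l.
    by case: (ltnP i.+1) => // /ltnW ->.
  - rewrite sumnE_nth (eq_bigr (fun i : 'I_m => r %/ m + (i < r %% m))%N).
      rewrite big_split /= sum_lt sum_nat_const card_ord mulnC.
      by rewrite (minn_idPl _) -?divn_eq // ltnW ?ltn_pmod.
    by move=> i _; rewrite nthB.
  - by rewrite /spread !nthB // subnDl; case: (0 < _)%N; case: (_ < _)%N.
rewrite /spread leq_subLR addn1; set q := nth 0%N mu m.-1 => le_d.
have mu_le i j : (i <= j)%N -> (j < m)%N -> (nth 0 mu j <= nth 0 mu i)%N.
  move=> le_ij lt_jm.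
  apply: (sorted_leq_nth geq_tr _ 0%N mu_dec) => //.
  - by move=> x; rewrite /= leqnn.
  - by rewrite inE size_tuple (leq_ltn_trans le_ij).
  - by rewrite inE size_tuple.
have has_q : has (pred1 q) mu.
  by apply/hasP; exists q => //=; rewrite mem_nth ?size_tuple.
set k := find (pred1 q) mu.
have lt_km : (k < m)%N by move: has_q; rewrite has_find size_tuple.
have mu_k : nth 0%N mu k = q by apply/eqP; apply: (nth_find 0%N has_q).
have nth_mu i : (i < m)%N -> nth 0%N mu i = (q + (i < k))%N.
  move=> lt_im; apply/eqP; case: (ltnP i k) => [lt_ik | le_ki].
    rewrite addn1 eqn_leq (leq_trans (mu_le 0%N i _ _)) // ltn_neqAle eq_sym.
    by rewrite (negbT (before_find 0%N lt_ik)) mu_le // -ltnS prednK.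
  by rewrite addn0 eqn_leq -{1}mu_k !mu_le // -ltnS prednK.
have r_eq : r = (q * m + k)%N.
  rewrite -mu_sum sumnE_nth (eq_bigr (fun i : 'I_m => q + (i < k))%N).
    by rewrite big_split /= sum_lt sum_nat_const card_ord mulnC (minn_idPl _) // ltnW.
  by move=> i _; rewrite nth_mu.
apply: eq_from_tnth => i; rewrite !(tnth_nth 0%N) nth_mu // nthB //.
by rewrite r_eq divnMDl // modnMDl divn_small // modn_small // addn0.
Qed.

(* ell-tuples of labelled sets. *)
Definition admissible (m n ell : nat) (lam : m.-tuple nat)
    (U : {ffun 'I_ell -> {set 'I_n}}) : bool :=
  set_partition U &&
  [forall j : 'I_m, #|[set i | #|U i| == j %[mod m]]| ==
                    (ext_part ell lam j - ext_part ell lam j.+1)%N].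

Definition Qfun (C : fieldType) (m n ell : nat) (z : 'I_n -> C)
    (U : {ffun 'I_ell -> {set 'I_n}}) : {mpoly C[m * n]} :=
  \prod_(i < ell) Pset z (U i) (balanced m #|U i|).

(* Zariski open subsets of affine n-space: complements of common zero sets of   *)
(* families of polynomials.                                                     *)
Definition zariski_open (C : fieldType) (n : nat) (O : ('I_n -> C) -> Prop) : Prop :=
  exists S : {mpoly C[n]} -> Prop,
    forall z, O z <-> exists2 f, S f & f.@[z] != 0.

(* Main.v *)
(** Pairing a multilinear polynomial p with the words w in {1..m}^n through its
    coefficients turns the operators e_ij and e^z_ij into operators on functions
    of words.

    Each Q(U) is a conformal block: by Lagrange interpolation the derivations
    e_ij with i < j kill every factor P^(U_k), and e^z_1m kills P^(U_k), or only
    its square does when m divides |U_k|, which happens for ell - d(lambda) sets.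

    For the converse call a word restricted when the letter counts of all its
    suffixes are partitions of spread at most ell. Two facts hold for generic z.
    - A conformal block of weight lambda vanishing at all restricted words of
      content lambda is zero. By induction on n: as z_1 tends to infinity the
      coefficients of p with respect to the first letter become conformal blocks
      for the remaining points.
    - Every restricted word w has a partitioning U(w) such that, read from the
      end, the letters of each block run cyclically through 1, ..., m. The square
      matrix of the coefficients of Q(U(w)) at w' is invertible: along a curve on
      which z_1, ..., z_n have widely separated orders of magnitude, its leading
      part is diagonal up to rescaling rows and columns.
    So every block p agrees with a combination of the Q(U(w)) at all restricted
    words, hence equals it. *)

From HB Require Import structures.
Require Import Defs.
From mathcomp Require Import all_boot all_order all_algebra.
From mathcomp Require Import mpoly complex reals.
From mathcomp Require Import boolp zify ring.

Set Implicit Arguments.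
Unset Strict Implicit.
Unset Printing Implicit Defensive.

Import Order.TTheory GRing.Theory Num.Theory.
Local Open Scope ring_scope.

(** * Generic points and systems of linear equations with polynomial coefficients *)


Section Generic.

Variables (C : numFieldType) (n : nat).
Implicit Types (z : 'I_n -> C) (P : ('I_n -> C) -> Prop).

(** Genericity is witnessed by one principal open set: conjunction becomes a product of polynomials,
    and nonemptiness is kept as a point. *)
Definition generically P :=
  exists f : {mpoly C[n]},
    (exists z, f.@[z] != 0) /\ (forall z, f.@[z] != 0 -> P z).

Lemma generically_ex P : generically P -> exists z, P z.
Proof. by case=> f [[z fz] fP]; exists z; apply: fP. Qed.

Lemma generically_true P : (forall z, P z) -> generically P.
Proof.
move=> PT; exists 1; split=> // .
by exists (fun=> 0); rewrite meval1 oner_neq0.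
Qed.

Lemma generically_imp P Q : (forall z, P z -> Q z) -> generically P -> generically Q.
Proof. by move=> PQ [f [ef fP]]; exists f; split=> // z /fP/PQ. Qed.

Definition on_line (z1 z2 : 'I_n -> C) (f : {mpoly C[n]}) : {poly C} :=
  \sum_(mon <- msupp f)
    f@_mon *: \prod_i ((z1 i)%:P + (z2 i - z1 i) *: 'X) ^+ mon i.

Lemma on_lineE z1 z2 f t :
  (on_line z1 z2 f).[t] = f.@[fun i => z1 i + (z2 i - z1 i) * t].
Proof.
rewrite /on_line mevalE horner_sum; apply: eq_bigr => mon _.
rewrite hornerZ horner_prod; congr (_ * _); apply: eq_bigr => i _.
by rewrite horner_exp hornerD hornerC hornerZ hornerX.
Qed.

Lemma poly_nonroot (f : {poly C}) : f != 0 -> exists t, f.[t] != 0.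
Proof.
move=> nzf; pose s := [seq i%:R : C | i <- iota 0 (size f)].
have us : uniq s.
  by rewrite map_inj_uniq ?iota_uniq // => i j /eqP; rewrite eqr_nat => /eqP.
have [/allP all0|] := boolP (all (root f) s).
  have := max_poly_roots nzf (introT allP all0) us.
  by rewrite size_map size_iota ltnn.
by case/allPn => t _ nr; exists t.
Qed.

(** On the line joining a point where [f] is nonzero to one where [g] is, both restrict to nonzero
    univariate polynomials, so their product has a non-root. *)
Lemma generically_and P Q :
  generically P -> generically Q -> generically (fun z => P z /\ Q z).
Proof.
move=> [f [[z1 fz1] fP]] [g [[z2 gz2] gQ]]; exists (f * g); split; last first.
  by move=> z; rewrite mevalM mulf_eq0 negb_or => /andP[/fP ? /gQ].
have nzf : on_line z1 z2 f * on_line z1 z2 g != 0.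
  rewrite mulf_eq0 negb_or; apply/andP; split; apply/eqP => e0.
    have := on_lineE z1 z2 f 0; rewrite e0 horner0 => /esym/eqP.
    by rewrite (meval_eq _ (v2 := z1)) ?(negPf fz1) // => i; rewrite mulr0 addr0.
  have := on_lineE z1 z2 g 1; rewrite e0 horner0 => /esym/eqP.
  by rewrite (meval_eq _ (v2 := z2)) ?(negPf gz2) // => i; rewrite mulr1 addrC subrK.
have [t] := poly_nonroot nzf; rewrite hornerM !on_lineE => nz.
by eexists; rewrite mevalM; exact: nz.
Qed.

Lemma generically_all (I : finType) (P : I -> ('I_n -> C) -> Prop) :
  (forall i, generically (P i)) -> generically (fun z => forall i, P i z).
Proof.
move=> gP.
suff /(_ (enum I)) : forall s : seq I, generically (fun z => forall i, i \in s -> P i z).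
  by apply: generically_imp => z Pz i; apply: Pz; rewrite mem_enum.
elim=> [|i s IHs]; first exact: generically_true.
apply: generically_imp (generically_and (gP i) IHs) => z [Pi Ps] j.
by rewrite inE => /predU1P[->|/Ps].
Qed.

Variable T : finType.
Implicit Type c : T -> C.

Definition polyform (L : ('I_n -> C) -> (T -> C) -> C) :=
  exists M : T -> {mpoly C[n]}, forall z c, L z c = \sum_t (M t).@[z] * c t.

Lemma polyform_coord t : polyform (fun _ c => c t).
Proof.
exists (fun u => (u == t)%:R) => z c; rewrite (bigD1 t) //= eqxx meval1 mul1r.
by rewrite big1 ?addr0 // => u /negPf->; rewrite meval0 mul0r.
Qed.

Lemma polyform0 : polyform (fun _ _ => 0).
Proof. by exists (fun=> 0) => z c; rewrite big1 // => t _; rewrite meval0 mul0r. Qed.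

Lemma polyformM (f : {mpoly C[n]}) L :
  polyform L -> polyform (fun z c => f.@[z] * L z c).
Proof.
case=> M LM; exists (fun t => f * M t) => z c; rewrite LM big_distrr /=.
by apply: eq_bigr => t _; rewrite mevalM mulrA.
Qed.

Lemma polyformD L1 L2 :
  polyform L1 -> polyform L2 -> polyform (fun z c => L1 z c + L2 z c).
Proof.
case=> M1 LM1 [M2 LM2]; exists (fun t => M1 t + M2 t) => z c.
by rewrite LM1 LM2 -big_split; apply: eq_bigr => t _; rewrite mevalD mulrDl.
Qed.

Lemma polyform_sum (I : Type) (r : seq I) (Q : pred I) L :
  (forall i, polyform (L i)) -> polyform (fun z c => \sum_(i <- r | Q i) L i z c).
Proof.
move=> pL; elim: r => [|i r IHr].
  by case: polyform0 => M LM; exists M => z c; rewrite big_nil -LM.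
have [M LM] := polyformD (pL i) IHr; have [M' LM'] := IHr.
case Qi: (Q i); first by exists M => z c; rewrite big_cons Qi -LM.
by exists M' => z c; rewrite big_cons Qi -LM'.
Qed.

(* If M(z0) has a right inverse X, then det (M(z) X) is a polynomial in z that
   does not vanish at z0, and M(z) is injective wherever it does not vanish. *)
Lemma generically_ker0 (J : finType) (L : J -> ('I_n -> C) -> (T -> C) -> C) :
  (forall e, polyform (L e)) ->
  (exists z, forall c, (forall e, L e z c = 0) -> forall t, c t = 0) ->
  generically (fun z => forall c, (forall e, L e z c = 0) -> forall t, c t = 0).
Proof.
move=> /fin_all_exists[M LM] [z0 ker0].
pose A : 'M[{mpoly C[n]}]_(#|T|, #|J|) := \matrix_(t, e) M (enum_val e) (enum_val t).
pose Az z := map_mx (meval z) A.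
have mulA z (u : 'rV[C]_#|T|) e :
    (u *m Az z) 0 (enum_rank e) = L e z (fun t => u 0 (enum_rank t)).
  rewrite LM mxE (reindex_onto enum_rank enum_val) /=; last first.
    by move=> i _; rewrite enum_valK.
  under eq_bigl do rewrite enum_rankK eqxx.
  by apply: eq_bigr => t _; rewrite !mxE !enum_rankK mulrC.
have free0 : row_free (Az z0).
  rewrite -kermx_eq0; apply/eqP/row_matrixP => i; rewrite row0.
  have := mulmx_ker (Az z0) => /(congr1 (row i)); rewrite row_mul row0.
  move: (row i _) => u uA; apply/rowP => k.
  rewrite mxE -[k]enum_valK; apply: (ker0 (fun t => u 0 (enum_rank t))) => e.
  by rewrite -mulA uA mxE.
have [X AX] := row_freeP free0.
pose f := \det (A *m map_mx (@mpolyC n C) X).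
have fE z : f.@[z] = \det (Az z *m X).
  rewrite /f -det_map_mx map_mxM /=; congr (\det (_ *m _)).
  by apply/matrixP => i j; rewrite !mxE mevalC.
exists f; split; first by exists z0; rewrite fE AX det1 oner_neq0.
move=> z; rewrite fE => nz c Lc t.
pose u : 'rV[C]_#|T| := \row_k c (enum_val k).
have uA : u *m Az z = 0.
  apply/rowP => k; rewrite [RHS]mxE -[k]enum_valK mulA -(Lc (enum_val k)).
  by congr (L _ z _); apply: funext => t'; rewrite mxE enum_rankK.
have inv : Az z *m X \in unitmx by rewrite unitmxE unitfE.
have : u *m (Az z *m X) = 0 by rewrite mulmxA uA mul0mx.
move/(congr1 (mulmx^~ (invmx (Az z *m X)))); rewrite mul0mx mulmxK //.
by move/rowP/(_ (enum_rank t)); rewrite !mxE enum_rankK.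
Qed.

End Generic.

(** * Words *)


Notation word m n := {ffun 'I_n -> 'I_m} (only parsing).

Section Words.

Variable m : nat.

Definition upd n (v : word m n) (a : 'I_n) (j : 'I_m) : word m n :=
  [ffun b => if b == a then j else v b].

Definition consw n (j : 'I_m) (v : word m n) : word m n.+1 :=
  [ffun a => if unlift ord0 a is Some b then v b else j].

Definition behw n (w : word m n.+1) : word m n := [ffun b => w (lift ord0 b)].

Definition cnt n (v : word m n) (j : 'I_m) : nat := (\sum_a (v a == j))%N.

Lemma upd_same n (v : word m n) a j : upd v a j a = j.
Proof. by rewrite ffunE eqxx. Qed.

Lemma upd_other n (v : word m n) a j b : b != a -> upd v a j b = v b.
Proof. by rewrite ffunE => /negPf->. Qed.

Lemma upd_upd n (v : word m n) a i j : upd (upd v a i) a j = upd v a j.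
Proof. by apply/ffunP => b; rewrite !ffunE; case: eqP. Qed.

Lemma updC n (v : word m n) a b i j : a != b ->
  upd (upd v a i) b j = upd (upd v b j) a i.
Proof.
by move=> ab; apply/ffunP => x; rewrite !ffunE; case: (x =P b) => // ->; rewrite eq_sym (negPf ab).
Qed.

Lemma upd_id n (v : word m n) a : upd v a (v a) = v.
Proof. by apply/ffunP => b; rewrite !ffunE; case: eqP => // ->. Qed.

Lemma consw0 n j (v : word m n) : consw j v ord0 = j.
Proof. by rewrite ffunE unlift_none. Qed.

Lemma conswS n j (v : word m n) b : consw j v (lift ord0 b) = v b.
Proof. by rewrite ffunE liftK. Qed.

Lemma consw_beh n (w : word m n.+1) : consw (w ord0) (behw w) = w.
Proof.
by apply/ffunP => a; rewrite ffunE; case: unliftP => [b ->|->]; rewrite ?ffunE.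
Qed.

Lemma behw_cons n j (v : word m n) : behw (consw j v) = v.
Proof. by apply/ffunP => b; rewrite ffunE conswS. Qed.

Lemma upd_cons0 n j (v : word m n) i : upd (consw j v) ord0 i = consw i v.
Proof. by apply/ffunP => a; rewrite !ffunE; case: unliftP => [b ->|->]. Qed.

Lemma upd_consS n j (v : word m n) b i :
  upd (consw j v) (lift ord0 b) i = consw j (upd v b i).
Proof.
apply/ffunP => a; rewrite !ffunE; case: unliftP => [x ->|->] //.
by rewrite ffunE (inj_eq lift_inj).
Qed.

Lemma cnt_cons n j (v : word m n) i : cnt (consw j v) i = ((j == i) + cnt v i)%N.
Proof.
by rewrite /cnt big_ord_recl consw0; congr (_ + _)%N; apply: eq_bigr => a _; rewrite conswS.
Qed.

Lemma cntD1 n (v : word m n) a i :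
  cnt v i = ((v a == i) + \sum_(b | b != a) (v b == i))%N.
Proof. by rewrite /cnt (bigD1 a). Qed.

Lemma cnt_upd n (v : word m n) a j i :
  (cnt (upd v a j) i + (v a == i) = cnt v i + (j == i))%N.
Proof.
rewrite !(cntD1 _ a) upd_same.
rewrite (eq_bigr (fun b => v b == i : nat)) => [|b /upd_other->] //.
by rewrite addnAC [RHS]addnAC [X in (X + _)%N]addnC.
Qed.

(** Changing a letter is a bijection with the reverse change as inverse. This transposes operators,
    in [opw_adj] and in passing from polynomials to coefficients. *)
Lemma sum_upd_exchange (V : nmodType) n (i j : 'I_m)
    (F : 'I_n -> {ffun 'I_n -> 'I_m} -> {ffun 'I_n -> 'I_m} -> V) :
  \sum_(v : {ffun 'I_n -> 'I_m}) \sum_(a | v a == i) F a v (upd v a j) =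
  \sum_(v : {ffun 'I_n -> 'I_m}) \sum_(a | v a == j) F a (upd v a i) v.
Proof.
rewrite (exchange_big_dep predT) //= [RHS](exchange_big_dep predT) //=.
apply: eq_bigr => a _; rewrite (reindex_onto (fun v => upd v a i) (fun v => upd v a j)) /=.
  apply: eq_big => [v|v /andP[_ /eqP <-]].
    by rewrite upd_same eqxx upd_upd; apply/eqP/eqP => [<-|<-]; rewrite ?upd_same ?upd_id.
  by rewrite !upd_upd.
by move=> v /eqP va; rewrite upd_upd -va upd_id.
Qed.

(** The integral points of the closed fundamental alcove dilated by [ell]. *)
Definition alcove (ell : nat) (mu : 'I_m -> nat) : bool :=
  [forall i : 'I_m, forall j : 'I_m, (i <= j)%N ==> (mu j <= mu i <= mu j + ell)%N].

Lemma alcoveP ell mu :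
  reflect (forall i j : 'I_m, (i <= j)%N -> (mu j <= mu i)%N /\ (mu i <= mu j + ell)%N)
          (alcove ell mu).
Proof.
apply: (iffP forallP) => [H i j ij|H i].
  by have /forallP/(_ j)/implyP/(_ ij)/andP[] := H i.
by apply/forallP => j; apply/implyP => ij; have [-> ->] := H i j ij.
Qed.

Fixpoint restricted (ell n : nat) : word m n -> bool :=
  if n is n'.+1 then
    fun w => alcove ell (cnt w) && restricted ell (behw w)
  else fun=> true.

End Words.

(** * The operators on coefficient functions of words *)

Section Operators.

Variables (C : numClosedFieldType) (m : nat).

(** If [c] lists the coefficients of p, this lists those of e^z_ij p: a letter [i] of [v] comes from
    a letter [j]. *)
Definition opw n (z : 'I_n -> C) (i j : 'I_m) (c : word m n -> C) : word m n -> C :=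
  fun v => \sum_(a | v a == i) z a * c (upd v a j).

Definition tailc n (c : word m n.+1 -> C) (j : 'I_m) : word m n -> C :=
  fun v => c (consw j v).

Definition consz n (x : C) (z : 'I_n -> C) : 'I_n.+1 -> C :=
  fun a => if unlift ord0 a is Some b then z b else x.

Lemma opw_cons n (z : 'I_n.+1 -> C) i j c k (v : word m n) :
  opw z i j c (consw k v) =
    (if k == i then z ord0 * c (consw j v) else 0) +
    opw (fun b => z (lift ord0 b)) i j (tailc c k) v.
Proof.
rewrite /opw big_mkcond big_ord_recl consw0 upd_cons0; congr (_ + _).
rewrite [RHS]big_mkcond; apply: eq_bigr => b _.
by rewrite conswS upd_consS.
Qed.

Definition one_z n : 'I_n -> C := fun=> 1.

Lemma opw_linear n (z : 'I_n -> C) i j x (c d : word m n -> C) :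
  opw z i j (fun v => x * c v + d v) = fun v => x * opw z i j c v + opw z i j d v.
Proof.
apply: funext => v; rewrite /opw big_distrr -big_split; apply: eq_bigr => a _ /=.
by ring.
Qed.

Lemma opw0 n (z : 'I_n -> C) i j : opw z i j (fun=> 0) = fun _ : word m n => 0.
Proof. by apply: funext => v; rewrite /opw big1 // => a _; rewrite mulr0. Qed.

Lemma opw_adj n (i j : 'I_m) (c d : word m n -> C) : 
  \sum_v opw (@one_z n) i j c v * d v = \sum_v c v * opw (@one_z n) j i d v.
Proof.
rewrite /opw; under eq_bigr do rewrite big_distrl /=.
under [RHS]eq_bigr do rewrite big_distrr /=.
rewrite (sum_upd_exchange i j (fun a v w => one_z a * c w * d v)).
by apply: eq_bigr => v _; apply: eq_bigr => a _; ring.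
Qed.

(** The relation [e_ij, e_ji] = e_ii - e_jj: changes at two different positions commute, so only the
    terms hitting one position twice survive. *)
Lemma opw_comm n (i j : 'I_m) (c : word m n -> C) v : i != j ->
  opw (@one_z n) i j (opw (@one_z n) j i c) v =
  opw (@one_z n) j i (opw (@one_z n) i j c) v + ((cnt v i)%:R - (cnt v j)%:R) * c v.
Proof.
have aux (k l : 'I_m) : k != l ->
  opw (@one_z n) k l (opw (@one_z n) l k c) v =
  \sum_(a | v a == k) \sum_(b | v b == l) c (upd (upd v a l) b k) + (cnt v k)%:R * c v.
  move=> kl; rewrite /opw.
  have -> : (cnt v k)%:R * c v = \sum_(a | v a == k) c v.
    by rewrite /cnt natr_sum big_distrl [RHS]big_mkcond; apply: eq_bigr => a _ /=;
      case: eqP; rewrite (mul1r, mul0r).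
  rewrite -big_split; apply: eq_bigr => a /eqP va /=; rewrite mul1r.
  rewrite (bigD1 a) /= ?upd_same // addrC mul1r upd_upd -va upd_id; congr (_ + _).
  rewrite va; apply: eq_big => [b|b _]; last by rewrite mul1r.
  have [->|ab] := eqVneq b a; first by rewrite andbF va (negPf kl).
  by rewrite andbT upd_other.
move=> ij; rewrite (aux _ _ ij) (aux j i); last by rewrite eq_sym.
rewrite exchange_big /=.
rewrite (eq_bigr (fun b => \sum_(a | v a == i) c (upd (upd v b i) a j))).
  by ring.
move=> b /eqP vb; apply: eq_bigr => a /eqP va; rewrite updC //.
by apply: contraNneq ij => ab; rewrite -va -vb ab.
Qed.

(* The highest weight vectors of weight mu, in coordinates. *)
Definition singular n (mu : 'I_m -> nat) (c : word m n -> C) : Prop :=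
  (forall w, c w != 0 -> cnt w =1 mu) /\
  (forall i j : 'I_m, (i < j)%N -> forall v, opw (@one_z n) i j c v = 0).

(* With e = e_{ij} and f = e_{ji} adjoint to each other,
   |f c|^2 = |e c|^2 + (mu_i - mu_j) |c|^2. *)
Lemma singular_dominant n (mu : 'I_m -> nat) (c : word m n -> C) (i j : 'I_m) :
  singular mu c -> (i < j)%N -> (mu i < mu j)%N -> forall v, c v = 0.
Proof.
move=> [wt ec] ij muij.
have nij : i != j by rewrite neq_ltn ij.
pose d v := (c v)^*.
have opd k l v : opw (@one_z n) k l d v = (opw (@one_z n) k l c v)^*.
  by rewrite /opw rmorph_sum; apply: eq_bigr => a _; rewrite !mul1r.
have normf : \sum_v `|opw (@one_z n) j i c v| ^+ 2 =
    ((mu i)%:R - (mu j)%:R) * \sum_v `|c v| ^+ 2.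
  under eq_bigr do rewrite normCK -opd.
  rewrite opw_adj big_distrr; apply: eq_bigr => v _ /=.
  rewrite opw_comm // [X in _ * (X + _)](_ : _ = 0); last first.
    have -> : opw (@one_z n) i j d = fun=> 0.
      by apply: funext => u; rewrite opd ec // conjC0.
    by rewrite opw0.
  have [->|nz] := eqVneq (c v) 0; first by rewrite normr0 expr0n mulr0 mul0r.
  by rewrite !(wt v nz) normCK /d; ring.
have ge0 : 0 <= \sum_v `|c v| ^+ 2 by apply: sumr_ge0 => v _; rewrite exprn_ge0.
have : 0 <= \sum_v `|opw (@one_z n) j i c v| ^+ 2.
  by apply: sumr_ge0 => v _; rewrite exprn_ge0.
rewrite normf nmulr_rge0 ?subr_lt0 ?ltr_nat // => le0.
have /eqP := le_anti (introT andP (conj le0 ge0)).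
rewrite psumr_eq0; last by move=> v _; rewrite exprn_ge0.
by move=> /allP all0 v; have := all0 v (mem_index_enum _); rewrite expf_eq0 normr_eq0 /= => /eqP.
Qed.

End Operators.

(** * Vanishing at the restricted words *)


Section PolySystems.

Variables (C : numFieldType) (n : nat) (T : finType).
Implicit Types (S : ('I_n -> C) -> (T -> C) -> Prop).

Definition polysystem S :=
  exists (J : finType) (L : J -> ('I_n -> C) -> (T -> C) -> C),
    (forall e, polyform (L e)) /\ (forall z c, S z c <-> forall e, L e z c = 0).

Lemma polysystem_eq0 L : polyform L -> polysystem (fun z c => L z c = 0).
Proof.
by move=> pL; exists unit, (fun=> L); split=> // z c; split=> [H _ //|]; apply.
Qed.

Lemma polysystem_and S1 S2 :
  polysystem S1 -> polysystem S2 -> polysystem (fun z c => S1 z c /\ S2 z c).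
Proof.
move=> [J1 [L1 [p1 S1E]]] [J2 [L2 [p2 S2E]]].
exists (J1 + J2)%type, (fun e => match e with inl e1 => L1 e1 | inr e2 => L2 e2 end).
split=> [[]//|z c]; rewrite S1E S2E; split=> [[H1 H2] []//|H].
by split=> e; [apply: (H (inl e)) | apply: (H (inr e))].
Qed.

Lemma polysystem_all (I : finType) (S : I -> ('I_n -> C) -> (T -> C) -> Prop) :
  (forall i, polysystem (S i)) -> polysystem (fun z c => forall i, S i z c).
Proof.
move=> /fin_all_exists[J] /fin_all_exists[L LE].
exists {i & J i}, (fun e => L (tag e) (tagged e)); split=> [[i e]|z c] /=.
  by have [] := LE i.
split=> [H [i e]|H i] /=; first by have [_ /(_ z c)[+ _]] := LE i; apply.
by have [_ /(_ z c)[_]] := LE i; apply=> e; apply: (H (Tagged J e)).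
Qed.

Lemma polysystem_if (b : bool) S :
  polysystem S -> polysystem (fun z c => b -> S z c).
Proof.
case: b => [|_]; last by exists void, (fun=> fun _ _ => 0); split=> [[]|z c]; split=> // _ [].
by case=> J [L [pL SE]]; exists J, L; split=> // z c; rewrite -SE; split=> [|? _]; [apply|].
Qed.

Lemma polysystem_iff S1 S2 :
  (forall z c, S1 z c <-> S2 z c) -> polysystem S1 -> polysystem S2.
Proof.
by move=> E [J [L [pL SE]]]; exists J, L; split=> // z c; rewrite -SE; split=> /E.
Qed.

Lemma polysystem_eq0_all (I : finType) (F : ('I_n -> C) -> (T -> C) -> I -> C) :
  (forall v, polyform (fun z c => F z c v)) ->
  polysystem (fun z c => forall v, F z c v = 0).
Proof. by move=> pF; apply: polysystem_all => v; apply: polysystem_eq0. Qed.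

(** The degenerations below rest on this: one special point with only the trivial solution gives
    generic ones. *)
Lemma generically_trivial S : polysystem S ->
  (exists z, forall c, S z c -> forall t, c t = 0) ->
  generically (fun z => forall c, S z c -> forall t, c t = 0).
Proof.
move=> [J [L [pL SE]]] [z0 S0].
apply: (generically_imp _ (generically_ker0 pL _)) => [z H c /SE|]; first exact: H.
by exists z0 => c /SE; apply: S0.
Qed.

End PolySystems.

Section OpwForms.

Variables (C : numClosedFieldType) (k : nat) (T : finType) (m n : nat).

Lemma polyform_opw (zz : 'I_n -> {mpoly C[k]}) i j
    (F : ('I_k -> C) -> (T -> C) -> {ffun 'I_n -> 'I_m} -> C) :
  (forall v, polyform (fun z c => F z c v)) ->
  forall v, polyform (fun z c => opw (fun a => (zz a).@[z]) i j (F z c) v).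
Proof.
by move=> pF v; apply: polyform_sum => a; apply: polyformM; apply: pF.
Qed.

Lemma polyform_iter_opw (zz : 'I_n -> {mpoly C[k]}) i j r
    (F : ('I_k -> C) -> (T -> C) -> {ffun 'I_n -> 'I_m} -> C) :
  (forall v, polyform (fun z c => F z c v)) ->
  forall v, polyform (fun z c => iter r (opw (fun a => (zz a).@[z]) i j) (F z c) v).
Proof.
by move=> pF; elim: r => // r IHr v; apply: (polyform_opw zz i j IHr v).
Qed.

End OpwForms.

(** * Degeneration of z_1 to infinity and induction on the number of points *)

Section UpperBound.

Variables (C : numClosedFieldType) (m ell : nat) (i0 im : 'I_m).
Hypotheses (i0_min : forall j : 'I_m, (i0 <= j)%N)
           (im_max : forall j : 'I_m, (j <= im)%N) (lt0m : (i0 < im)%N).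

Definition level (mu : 'I_m -> nat) : nat := (ell - (mu i0 - mu im))%N.

Definition block_system n (mu : 'I_m -> nat) (z : 'I_n -> C) (c : {ffun 'I_n -> 'I_m} -> C) :=
  singular mu c /\ forall v, iter (level mu).+1 (opw z i0 im) c v = 0.

(* The coordinates at the restricted words of content mu separate the
   elements of the block. *)
Definition separated n (mu : 'I_m -> nat) (z : 'I_n -> C) :=
  forall c, block_system mu z c /\
    (forall w, restricted ell w -> cnt w =1 mu -> c w = 0) -> forall w, c w = 0.

Let neqm0 : (im == i0) = false.
Proof. by apply/negbTE; rewrite neq_ltn lt0m orbT. Qed.

(** The first letter can turn from [im] into [i0] only once, so the binomial expansion of the power
    has just these two terms. *)
Lemma iter_opw_cons n x (z : 'I_n -> C) (c : {ffun 'I_n.+1 -> 'I_m} -> C) k l :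
  tailc (iter k (opw (consz x z) i0 im) c) l =
  fun v => iter k (opw z i0 im) (tailc c l) v +
    (if l == i0 then k%:R * x * iter k.-1 (opw z i0 im) (tailc c im) v else 0).
Proof.
elim: k l => [|k IHk] l; apply: funext => v; first by rewrite !mul0r if_same addr0.
rewrite {1}/tailc iterS opw_cons.
have -> : consz x z ord0 = x by rewrite /consz unlift_none.
have -> : (fun b => consz x z (lift ord0 b)) = z.
  by apply: funext => b; rewrite /consz liftK.
rewrite -[iter k _ c (consw im v)]/(tailc (iter k (opw (consz x z) i0 im) c) im v).
rewrite !IHk neqm0 addr0; case: (l == i0); last first.
  rewrite add0r iterS addr0; congr (opw z _ _ _ v).
  by apply: funext => u; rewrite addr0.
rewrite [X in opw z i0 im X](_ : _ = fun u => k%:R * x * 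
  iter k.-1 (opw z i0 im) (tailc c im) u + iter k (opw z i0 im) (tailc c l) u); last first.
  by apply: funext => u; rewrite addrC.
rewrite opw_linear iterS addrA addrC; congr (_ + _).
case: k {IHk} => [|k]; first by rewrite /= !mul0r addr0 mul1r.
by rewrite -iterS /= -[in RHS]natr1; ring.
Qed.

Definition pred_weight (mu : 'I_m -> nat) (j : 'I_m) : 'I_m -> nat :=
  fun l => (mu l - (l == j))%N.

Definition has_weight n (mu : 'I_m -> nat) (w : {ffun 'I_n -> 'I_m}) :=
  [forall j, cnt w j == mu j].

Lemma has_weightP n mu (w : {ffun 'I_n -> 'I_m}) :
  reflect (cnt w =1 mu) (has_weight mu w).
Proof. by apply: (iffP forallP) => H j; [apply/eqP | rewrite H]. Qed.

Lemma singularE n mu (c : {ffun 'I_n -> 'I_m} -> C) :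
  singular mu c <-> (forall w, ~~ has_weight mu w -> c w = 0) /\
    (forall i j : 'I_m, (i < j)%N -> forall v, opw (@one_z C n) i j c v = 0).
Proof.
split=> -[wt ec]; split=> // w.
  by move=> nw; apply/eqP; apply: contraNT nw => /wt/has_weightP.
by move=> nz; apply/has_weightP; apply: contraNT nz => /wt->.
Qed.

(* The equations satisfied on the block at z_0 = 1/x, in a form that still makes
   sense at x = 0. *)
Definition degenerate_system n mu (z : 'I_n -> C) (x : C)
    (c : {ffun 'I_n.+1 -> 'I_m} -> C) : Prop :=
  (singular mu c /\ (forall w, restricted ell w && has_weight mu w -> c w = 0)) /\
  ((forall l, l != i0 -> forall v, iter (level mu).+1 (opw z i0 im) (tailc c l) v = 0) /\
   (forall v, iter (level mu).+2 (opw z i0 im) (tailc c i0) v = 0)) /\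
  (forall v, x * iter (level mu).+1 (opw z i0 im) (tailc c i0) v +
     (level mu).+1%:R * iter (level mu) (opw z i0 im) (tailc c im) v = 0).

(** In e_il the first letter contributes only if [j] is [i], and then through the tail of the larger
    letter [l], which vanishes. *)
Lemma tail_singular n mu (c : {ffun 'I_n.+1 -> 'I_m} -> C) (j : 'I_m) :
  singular mu c -> (forall l : 'I_m, (j < l)%N -> forall v, tailc c l v = 0) ->
  singular (pred_weight mu j) (tailc c j).
Proof.
move=> [wt ec] top; split=> [v /wt cv l|i l il v].
  by rewrite /pred_weight -cv cnt_cons eq_sym addnC addnK.
have := ec i l il (consw j v); rewrite opw_cons; case: eqP => [ji|_].
  by rewrite -[c (consw l v)]/(tailc c l v) top ?ji // mulr0 add0r.
by rewrite add0r.
Qed.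

(** Descending induction on the first letter [j]. The tail at [j] is singular of the reduced weight.
    If that weight is in the alcove, the tail solves the block system for one point less; otherwise
    dominance or the level equation kills it. *)
Lemma degenerate_trivial n mu (z : 'I_n -> C) : alcove ell mu ->
  (forall j, alcove ell (pred_weight mu j) -> separated (pred_weight mu j) z) ->
  forall c, degenerate_system mu z 0 c -> forall w, c w = 0.
Proof.
move=> /alcoveP mu_alc IH c [[sing restr0] [[El E0] Em]] w.
suff tail0 t : forall j : 'I_m, (m - j <= t)%N -> forall v, tailc c j v = 0.
  by rewrite -(consw_beh w); apply: (tail0 m _ (leq_subr _ _)).
elim: t => [|t IHt] j; first by rewrite leqNgt subn_gt0 ltn_ord.
move=> jt; have top (l : 'I_m) : (j < l)%N -> forall v, tailc c l v = 0.
  by move=> jl; apply: IHt; have := ltn_ord l; lia.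
have singj := tail_singular sing top.
(* [pred_weight] truncates when [mu j] is 0, but then no word of weight [mu] starts with [j]. *)
have [mu_j0|mu_j_gt0] := posnP (mu j).
  move=> v; apply/eqP; apply: contraT => /sing.1 /(_ j).
  by rewrite cnt_cons eqxx mu_j0.
have Em' v : iter (level mu) (opw z i0 im) (tailc c im) v = 0.
  by have /eqP := Em v; rewrite mul0r add0r mulf_eq0 pnatr_eq0 => /eqP.
have [mu0m mu0mell] := mu_alc _ _ (i0_min im).
have [nu_alc|] := boolP (alcove ell (pred_weight mu j)).
  apply: (IH j nu_alc (tailc c j)); split; last first.
    move=> v vr vw; apply: restr0; apply/andP.
    have hw : cnt (consw j v) =1 mu.
      move=> l; rewrite cnt_cons vw /pred_weight eq_sym.
      by case: (l =P j) => [->|_]; rewrite ?subn0 // subnKC.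
    split; last exact/has_weightP.
    by rewrite /= behw_cons vr andbT (_ : alcove _ _ = alcove ell mu);
      [apply/alcoveP | congr alcove; apply: funext].
  split=> // v; have [nu0m nu0mell] := alcoveP _ _ nu_alc _ _ (i0_min im).
  move: mu_j_gt0 nu0m nu0mell; rewrite /level /pred_weight.
  (* Removing the first letter raises the level by one if it is [i0], lowers it by one if it is
     [im], and keeps it otherwise; the system has an equation for each case. *)
  have [->|j0] := eqVneq j i0.
    rewrite neqm0 subn0 /= => mu0_gt0 nu0m nu0mell.
    have -> : (ell - (mu i0 - 1 - mu im) = (level mu).+1)%N.
      by rewrite /level; lia.
    exact: E0.
  have [->|jm] := eqVneq j im.
    rewrite subn0 /= => mum_gt0 nu0m nu0mell.
    rewrite -iterS; have -> : ((ell - (mu i0 - (mu im - 1))).+1 = level mu)%N by rewrite /level; lia.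
    exact: Em'.
  rewrite !subn0 => _ _ _.
  exact: El.
case/forallPn => i; case/forallPn => l.
rewrite negb_imply negb_and -!ltnNge => /andP[il /orP[lt_il|]].
  apply: (singular_dominant singj _ lt_il); rewrite ltn_neqAle il andbT.
  by apply: contraTneq lt_il => /val_inj->; rewrite ltnn.
rewrite /pred_weight; have [mu_il mu_ilell] := mu_alc _ _ il.
(* The gap can exceed [ell] only if [l] is the removed letter and the gap in [mu] was exactly
   [ell]. *)
have [lj|_] := eqVneq l j; last by lia.
rewrite {}lj in il mu_il mu_ilell * => big_ij.
have [jm|jm] := eqVneq j im.
  have lev0 : level mu = 0%N.
    by have [] := mu_alc _ _ (i0_min i); rewrite /level -jm; lia.
  by move=> v; rewrite jm; have := Em' v; rewrite lev0.
(* As mu_i0 - mu_im is at most [ell], which is mu_i - mu_j, the parts at [j] and [im] agree;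
   lowering the former breaks dominance. *)
have lt_jm : (j < im)%N by rewrite ltn_neqAle (im_max j) andbT.
apply: (singular_dominant singj lt_jm).
have [] := mu_alc _ _ (i0_min i); rewrite /pred_weight eqxx [im == j]eq_sym (negPf jm).
have [] := mu_alc _ _ (im_max j).
lia.
Qed.

Lemma polysystem_singular k n mu :
  polysystem (fun (_ : 'I_k -> C) (c : {ffun 'I_n -> 'I_m} -> C) => singular mu c).
Proof.
apply: (polysystem_iff (fun _ c => iff_sym (singularE mu c))).
apply: polysystem_and.
  by apply: polysystem_all => w; apply/polysystem_if/polysystem_eq0/polyform_coord.
apply: polysystem_all => i; apply: polysystem_all => j; apply: polysystem_if.
apply: polysystem_eq0_all => v.
have [M ME] := polyform_opw (fun=> 1) i j (@polyform_coord C k _) v.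
exists M => z c; rewrite -ME; congr (opw _ _ _ _ _).
by apply: funext => a; rewrite meval1.
Qed.

Lemma polysystem_vanish k n (P : pred {ffun 'I_n -> 'I_m}) :
  polysystem (fun (_ : 'I_k -> C) (c : {ffun 'I_n -> 'I_m} -> C) => forall w, P w -> c w = 0).
Proof.
by apply: polysystem_all => w; apply/polysystem_if/polysystem_eq0/polyform_coord.
Qed.

Lemma polysystem_block n mu : polysystem (fun z (c : {ffun 'I_n -> 'I_m} -> C) =>
  block_system mu z c /\ (forall w, restricted ell w -> cnt w =1 mu -> c w = 0)).
Proof.
apply: polysystem_and; first apply: polysystem_and; first exact: polysystem_singular.
  apply: polysystem_eq0_all => v.
  have [M ME] := polyform_iter_opw (fun a => 'X_a) i0 im (level mu).+1 (@polyform_coord C n _) v.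
  exists M => z c; rewrite -ME; congr (iter _ (opw _ _ _) _ _).
  by apply: funext => a; rewrite mevalXU.
apply: (polysystem_iff _ (@polysystem_vanish _ _ (fun w => restricted ell w && has_weight mu w))).
move=> _ c; split=> [c0 w wr /has_weightP wt|c0 w /andP[wr /has_weightP]].
  by apply: c0; rewrite wr.
exact: c0.
Qed.

Lemma polysystem_degenerate n mu (z : 'I_n -> C) :
  polysystem (fun y (c : {ffun 'I_n.+1 -> 'I_m} -> C) =>
    degenerate_system mu z (y (@ord0 0)) c).
Proof.
have pE r l v : polyform (fun (_ : 'I_1 -> C) (c : {ffun 'I_n.+1 -> 'I_m} -> C) =>
    iter r (opw z i0 im) (tailc c l) v).
  have [M ME] := polyform_iter_opw (fun a => (z a)%:MP) i0 im r 
    (fun v => @polyform_coord C 1 _ (consw l v)) v.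
  exists M => y c; rewrite -ME; congr (iter _ (opw _ _ _) _ _).
  by apply: funext => a; rewrite mevalC.
do 2!apply: polysystem_and; first exact: polysystem_singular.
- exact: polysystem_vanish.
- apply: polysystem_and; last by apply: polysystem_eq0_all => v.
  by apply: polysystem_all => l; apply/polysystem_if/polysystem_eq0_all => v.
apply: polysystem_eq0_all => v.
have [M ME] := polyformD (polyformM 'X_ord0 (pE (level mu).+1 i0 v))
  (polyformM ((level mu).+1%:R)%:MP (pE (level mu) im v)).
by exists M => y c; rewrite -ME mevalXU mevalC.
Qed.

(** The limit is taken algebraically, with x = 1/z_1 as parameter: the system has only the trivial
    solution at x = 0, hence also at some nonzero x, and this single point suffices. *)
Lemma separated_generic n mu : alcove ell mu -> generically (@separated n mu).
Proof.
elim: n mu => [|n IHn] mu mu_alc.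
  apply: generically_true => z c [[[wt _] _] c0] w.
  have [//|nz] := eqVneq (c w) 0.
  by apply: c0 => //; apply: wt.
apply: (generically_trivial (@polysystem_block n.+1 mu)).
have /generically_ex[z' z'P] : generically (fun z : 'I_n -> C =>
    forall j, alcove ell (pred_weight mu j) -> separated (pred_weight mu j) z).
  apply: generically_all => j.
  have [/IHn|_] := boolP (alcove ell (pred_weight mu j)).
    by apply: generically_imp.
  exact: generically_true.
have /generically_ex[y [yP /eqP y_neq0]] : generically (fun y : 'I_1 -> C =>
    (forall c, degenerate_system mu z' (y ord0) c -> forall w, c w = 0) /\ y ord0 <> 0).
  apply: generically_and.
    apply: (generically_trivial (polysystem_degenerate mu z')); exists (fun=> 0) => c.
    exact: degenerate_trivial.
  exists 'X_ord0; split; first by exists (fun=> 1); rewrite mevalXU oner_neq0.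
  by move=> z; rewrite mevalXU => /eqP.
exists (consz (y ord0)^-1 z') => c [[sing Dc] c0]; apply: yP.
have D l v : iter (level mu).+1 (opw z' i0 im) (tailc c l) v +
    (if l == i0 then (level mu).+1%:R * (y ord0)^-1 *
       iter (level mu) (opw z' i0 im) (tailc c im) v else 0) = 0.
  have := Dc (consw l v).
  rewrite -[LHS]/(tailc (iter _ (opw (consz (y ord0)^-1 z') i0 im) _) l v).
  by rewrite iter_opw_cons.
have Em v : iter (level mu).+1 (opw z' i0 im) (tailc c im) v = 0.
  by have := D im v; rewrite neqm0 addr0.
split; first by split=> // w /andP[wr /has_weightP]; apply: c0.
split; last first.
  by move=> v; have := D i0 v; rewrite eqxx => /(congr1 ( *%R (y ord0)));
    rewrite mulr0 => <-; field.
split=> [l l0 v|v]; first by have := D l v; rewrite (negPf l0) addr0.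
rewrite iterS.
(* This power of the tail at [i0] is a multiple of a power of the tail at [im], which one more
   application kills by [Em]. *)
have -> : iter (level mu).+1 (opw z' i0 im) (tailc c i0) = fun v =>
    (- ((level mu).+1%:R * (y ord0)^-1)) * iter (level mu) (opw z' i0 im) (tailc c im) v + 0.
  apply: funext => u; have := D i0 u; rewrite eqxx => /eqP.
  by rewrite addr_eq0 => /eqP->; rewrite addr0 mulNr.
rewrite (opw_linear _ _ _ _ _ (fun=> 0)) opw0 -iterS Em; ring.
Qed.

End UpperBound.

(** * The rational functions P *)


Section Lagrange.

Variables (F : fieldType) (I : finType).

Lemma prod_XsubC_set_monic (A : {pred I}) (z : I -> F) :
  \prod_(b in A) ('X - (z b)%:P) \is monic.
Proof. by apply: monic_prod => b _; apply: monicXsubC. Qed.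

Lemma size_prod_XsubC_set (A : {pred I}) (z : I -> F) :
  size (\prod_(b in A) ('X - (z b)%:P)) = #|A|.+1.
Proof. by rewrite -big_enum size_prod_XsubC -cardE. Qed.

(** [f] equals its Lagrange interpolant at the points of [A]; compare top coefficients. *)
Lemma lagrange_coef (A : {set I}) (z : I -> F) (f : {poly F}) :
  {in A &, injective z} -> (size f <= #|A|)%N ->
  \sum_(a in A) f.[z a] / \prod_(b in A :\ a) (z a - z b) = f`_(#|A|.-1).
Proof.
move=> injz sf.
pose d a := \prod_(b in A :\ a) (z a - z b).
pose L := \sum_(a in A) (f.[z a] / d a) *: \prod_(b in A :\ a) ('X - (z b)%:P).
have cardA a : a \in A -> #|A :\ a|.+1 = #|A| by move=> aA; rewrite [RHS](cardsD1 a) aA.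
have nzd a : a \in A -> d a != 0.
  move=> aA; apply/prodf_neq0 => b; rewrite !inE => /andP[ba bA].
  by rewrite subr_eq0; apply: contraNneq ba => /(injz _ _ aA bA)->.
suff fL : f = L.
  rewrite [in RHS]fL coef_sum; apply: eq_bigr => a aA; rewrite coefZ.
  have := prod_XsubC_set_monic (mem (A :\ a)) z.
  rewrite monicE lead_coefE size_prod_XsubC_set -(cardA a aA) /= => /eqP->.
  by rewrite mulr1.
apply/eqP; rewrite -subr_eq0; apply/eqP.
apply: (@roots_geq_poly_eq0 _ _ [seq z a | a <- enum A]).
- apply/allP => x /mapP[a]; rewrite mem_enum => aA ->; rewrite rootE hornerD hornerN horner_sum.
  rewrite (bigD1 a) //= hornerZ horner_prod.
  under eq_bigr do rewrite hornerXsubC.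
  rewrite -/(d a) divfK ?nzd // big1 ?addr0 ?subrr // => b /andP[bA ba].
  rewrite hornerZ horner_prod (bigD1 a) ?inE ?aA ?andbT 1?eq_sym //=.
  by rewrite hornerXsubC subrr mul0r mulr0.
- rewrite map_inj_in_uniq ?enum_uniq // => a b; rewrite !mem_enum; exact: injz.
rewrite size_map -cardE (leq_trans (size_polyD _ _)) // geq_max sf size_polyN.
apply: (leq_trans (size_sum _ _ _)); apply/bigmax_leqP => a aA.
by rewrite (leq_trans (size_scale_leq _ _)) // size_prod_XsubC_set cardA.
Qed.

End Lagrange.

Lemma cnt_card m n (v : {ffun 'I_n -> 'I_m}) j : cnt v j = #|[set a | v a == j]|.
Proof.
rewrite -sum1_card /cnt big_mkcond [RHS]big_mkcond; apply: eq_bigr => a _.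
by rewrite inE; case: eqP.
Qed.

(** * The coefficients of P and the action of the operators on them *)

Section Coefficients.

Variables (C : numClosedFieldType) (m n : nat) (z : 'I_n -> C).
Hypothesis z_inj : injective z.
Implicit Types (v : {ffun 'I_n -> 'I_m}) (mu : 'I_m -> nat).

(** The product R(z_I1|...|z_Im), where I_j is the set of positions with letter j. *)
Definition Rword v : C := \prod_a \prod_(b | (v a < v b)%N) (z a - z b).

Definition pcoef mu v : C := if has_weight mu v then (Rword v)^-1 else 0.

Let pairf v a b := if (v a < v b)%N then z a - z b else 1.

Lemma RwordD1 v a : Rword v =
  (\prod_(b | b != a) (pairf v a b * pairf v b a)) *
  \prod_(x | x != a) \prod_(b | b != a) pairf v x b.
Proof.
rewrite /Rword; under eq_bigr do rewrite big_mkcond.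
rewrite (bigD1 a) //= (bigD1 a) //= ltnn mul1r big_split /= -mulrA; congr (_ * _).
by rewrite -big_split; apply: eq_bigr => x _; rewrite (bigD1 a).
Qed.

Definition between (i j : 'I_m) v : nat := (\sum_b (i <= v b < j))%N.

(** Moving [a] from [i] to [j] reverses the factors with letters strictly between, removes those
    with letter [j] and creates reversed ones with letter [i]. The quotient has the shape summed in
    [lagrange_coef]; the [.-1] leaves out [a] itself. *)
Lemma Rword_upd (i j : 'I_m) v a : (i < j)%N -> v a = i ->
  (Rword (upd v a j))^-1 = (-1) ^+ (between i j v).-1 * (Rword v)^-1 *
    ((\prod_(b | v b == j) (z a - z b)) /
     \prod_(b in [set b | v b == i] :\ a) (z a - z b)).
Proof.
move=> ij va.
(* The quotient of the new by the old factor for the pair of [a] and [b]. *)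
pose t b := (-1) ^+ (i <= v b < j)%N * (if v b == i then z a - z b else 1) /
  (if v b == j then z a - z b else 1).
have nz b : b != a -> z a - z b != 0.
  by move=> ba; rewrite subr_eq0; apply: contraNneq ba => /z_inj->.
have -> : Rword (upd v a j) = Rword v * \prod_(b | b != a) t b.
  rewrite !(RwordD1 _ a) mulrAC; congr (_ * _); last first.
    by apply: eq_bigr => x xa; apply: eq_bigr => b ba; rewrite /pairf !upd_other.
  rewrite -big_split; apply: eq_bigr => b ba /=.
  rewrite /pairf upd_same !upd_other // va /t.
  have := nz b ba; rewrite -!val_eqE /=; case: (ltngtP i (v b)); case: (ltngtP (v b) j) => //=;
    move: ij => + + + nzb; rewrite ?expr0 ?expr1 ?divr1 ?mulr1 ?mul1r; try lia; move=> *;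
    by [|field].
have -> : \prod_(b | b != a) t b = (-1) ^+ (between i j v).-1 *
    \prod_(b in [set b | v b == i] :\ a) (z a - z b) / \prod_(b | v b == j) (z a - z b).
  rewrite /t !big_split /= -expr_sum prodfV; congr (_ ^+ _ * _ / _).
  - by rewrite /between [in RHS](bigD1 a) //= va leqnn ij.
  - by rewrite -big_mkcondr; apply: eq_bigl => b; rewrite !inE.
  rewrite -big_mkcondr; apply: eq_bigl => b; case: eqP => //= ->.
  by case: eqP => // vb; rewrite -vb va ltnn in ij.
by rewrite !invfM invrK invr_sign; ring.
Qed.

Definition shift_weight mu (i j : 'I_m) : 'I_m -> nat :=
  fun l => (mu l + (l == i) - (l == j))%N.

Lemma has_weight_upd mu v (i j : 'I_m) a : v a = i -> i != j -> (0 < mu j)%N ->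
  has_weight mu (upd v a j) = has_weight (shift_weight mu i j) v.
Proof.
move=> va ij muj; apply/has_weightP/has_weightP => H l.
  by have := cnt_upd v a j l; rewrite H va /shift_weight ![_ == l]eq_sym; lia.
have := cnt_upd v a j l; rewrite H va /shift_weight ![_ == l]eq_sym.
by case: (l =P j) => [->|_]; rewrite /= 1?eq_sym ?(negPf ij) /=; lia.
Qed.

(** The common value of [between] on words of weight [mu], so that the sign in [Rword_upd] is the
    same in all summands. *)
Definition outer (mu : 'I_m -> nat) (i j : 'I_m) : nat := (\sum_(l < m | i <= l < j) mu l)%N.

Lemma between_weight (i j : 'I_m) mu v : has_weight mu v ->
  between i j v = outer mu i j.
Proof.
move=> /has_weightP wt; rewrite /outer; under eq_bigr do rewrite -wt /cnt.
rewrite exchange_big /=; apply: eq_bigr => b _; rewrite big_mkcond (bigD1 (v b)) //= eqxx.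
rewrite big1 ?addn0 => [|l]; first by case: ifP.
by rewrite eq_sym => /negPf->; rewrite if_same.
Qed.

Definition below (j : 'I_m) v : {poly C} := \prod_(b | v b == j) ('X - (z b)%:P).

Lemma below_monic j v : below j v \is monic.
Proof. by apply: monic_prod => b _; apply: monicXsubC. Qed.

Lemma size_below j v : size (below j v) = (cnt v j).+1.
Proof.
rewrite cnt_card -(size_prod_XsubC_set (mem [set a | v a == j]) z) /below.
congr (size (polyseq _)).
by apply: eq_bigl => b; rewrite inE.
Qed.

(** By [Rword_upd] this sums the values of [h * below j v] at the mu_i + 1 positions with letter [i]
    over Lagrange denominators; the size bound keeps the degree at most mu_i. Taking 1 for [h] gives
    e_ij, taking ['X] gives e^z_ij. *)
Lemma opw_pcoef (h : {poly C}) mu (i j : 'I_m) v : (i < j)%N -> (0 < mu j)%N ->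
  (size h + mu j <= mu i + 2)%N ->
  opw (fun a => h.[z a]) i j (pcoef mu) v =
    (-1) ^+ (outer (shift_weight mu i j) i j).-1 *
    pcoef (shift_weight mu i j) v * (h * below j v)`_(mu i).
Proof.
move=> ij muj sh; have nij : i != j by rewrite neq_ltn ij.
rewrite /opw /pcoef; case: ifP => wt; last first.
  rewrite mulr0 mul0r big1 // => a /eqP va.
  by rewrite (has_weight_upd va) // wt mulr0.
have cnti : cnt v i = (mu i).+1.
  by rewrite (has_weightP _ _ wt) /shift_weight eqxx (negPf nij) subn0 addn1.
have cntj : (cnt v j = (mu j).-1)%N.
  by rewrite (has_weightP _ _ wt) /shift_weight eqxx eq_sym (negPf nij) addn0 subn1.
have : (size (h * below j v)%R <= #|[set b | v b == i]|)%N.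
  rewrite -cnt_card cnti (leq_trans (size_polyMleq _ _)) // size_below cntj prednK //; lia.
move/(lagrange_coef (in2W z_inj)); rewrite -cnt_card cnti /= => <-.
rewrite big_distrr /=; apply: eq_big => [a|a /eqP va]; first by rewrite inE.
rewrite (has_weight_upd va) // wt (Rword_upd ij va) (between_weight _ _ wt) hornerM horner_prod.
under [in RHS]eq_bigr do rewrite hornerXsubC.
by ring.
Qed.

Lemma opw_pcoef_mu0 u mu (i j : 'I_m) v : mu j = 0%N ->
  opw u i j (pcoef mu) v = 0.
Proof.
move=> muj; rewrite /opw big1 // => a _; rewrite /pcoef; case: has_weightP => [wt|_]; last by rewrite mulr0.
by have := cntD1 (upd v a j) a j; rewrite wt muj upd_same eqxx add1n.
Qed.

Lemma opw_pcoef_small (h : {poly C}) mu (i j : 'I_m) v : (i < j)%N ->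
  (size h + mu j <= mu i + 1)%N -> opw (fun a => h.[z a]) i j (pcoef mu) v = 0.
Proof.
move=> ij sh; have [/opw_pcoef_mu0->//|muj] := posnP (mu j).
rewrite opw_pcoef //; last by lia.
rewrite /pcoef; case: ifP => [wt|_]; last by rewrite mulr0 mul0r.
rewrite [X in _ * X]nth_default ?mulr0 // (leq_trans (size_polyMleq _ _)) // size_below.
rewrite (has_weightP _ _ wt) /shift_weight eqxx (_ : (j == i) = false); first by lia.
by apply/negbTE; rewrite neq_ltn ij orbT.
Qed.

(** Here the degree is exactly mu_i, so the extracted coefficient is the leading one. *)
Lemma opw_pcoef_monic (h : {poly C}) mu (i j : 'I_m) : (i < j)%N ->
  h \is monic -> (0 < mu j)%N -> (size h + mu j = mu i + 2)%N ->
  opw (fun a => h.[z a]) i j (pcoef mu) = fun v =>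
    (-1) ^+ (outer (shift_weight mu i j) i j).-1 * pcoef (shift_weight mu i j) v.
Proof.
move=> ij hm muj sh; apply: funext => v; rewrite opw_pcoef ?sh //.
rewrite /pcoef; case: ifP => [wt|_]; last by rewrite !mulr0 mul0r.
have := monicMl (below j v) hm; rewrite below_monic monicE lead_coefE.
rewrite size_proper_mul ?(eqP hm) ?mul1r ?lead_coef_eq0 ?monic_neq0 ?below_monic //.
rewrite size_below (has_weightP _ _ wt) /shift_weight eqxx (_ : (j == i) = false); last first.
  by apply/negbTE; rewrite neq_ltn ij orbT.
have -> : ((size h + (mu j + false - true).+1).-1.-1 = mu i)%N by lia.
by move/eqP->; rewrite mulr1.
Qed.

(* The step from mu to shift_weight mu widens the gap between the two parts, so
   the second application falls under opw_pcoef_small. *)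
Lemma opw_pcoef_square mu (i j : 'I_m) : (i < j)%N -> mu i = mu j ->
  opw z i j (opw z i j (pcoef mu)) = fun=> 0.
Proof.
move=> ij muE; have zX : z = fun a => ('X : {poly C}).[z a].
  by apply: funext => a; rewrite hornerX.
have [muj|muj] := posnP (mu j).
  rewrite [X in opw _ _ _ X](_ : _ = fun=> 0) ?opw0 //.
  by apply: funext => v; apply: opw_pcoef_mu0.
rewrite [X in opw X i j (opw X _ _ _)]zX opw_pcoef_monic ?monicX ?size_polyX //; last by lia.
set s := (-1) ^+ _; apply: funext => v.
have -> : (fun v => s * pcoef (shift_weight mu i j) v) =
   (fun v => s * pcoef (shift_weight mu i j) v + 0) by apply: funext => u; rewrite addr0.
rewrite (opw_linear _ _ _ _ _ (fun=> 0)) opw0 opw_pcoef_small ?mulr0 ?addr0 //.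
rewrite size_polyX /shift_weight !eqxx (_ : (j == i) = false) 1?(_ : (i == j) = false); first by lia.
  by apply/negbTE; rewrite neq_ltn ij.
by apply/negbTE; rewrite neq_ltn ij orbT.
Qed.

End Coefficients.

(** * Derivations and coordinates *)


Section Derivations.

Variables (K : comPzRingType) (A : comAlgType K) (D : {linear A -> A}).
Hypothesis leibniz : forall p q, D (p * q) = D p * q + p * D q.

Lemma derivation1 : D 1 = 0.
Proof.
by have := leibniz 1 1; rewrite !mulr1 mul1r => /esym/eqP; rewrite addrC -subr_eq0 addrK => /eqP.
Qed.

Lemma derivation_prod (I : eqType) (r : seq I) (F : I -> A) : uniq r ->
  D (\prod_(a <- r) F a) = \sum_(a <- r) D (F a) * \prod_(b <- r | b != a) F b.
Proof.
elim: r => [|x r IHr] /=; first by rewrite !big_nil derivation1.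
move=> /andP[xr ur]; rewrite !big_cons leibniz IHr // eqxx /=; congr (_ * _ + _).
  rewrite big_seq [RHS]big_seq_cond; apply: eq_bigl => b.
  by have [->|] := eqVneq b x; rewrite ?andbT ?(negPf xr).
rewrite big_distrr /= big_seq [RHS]big_seq; apply: eq_bigr => a ar.
rewrite big_cons ifT; first by rewrite mulrCA.
by apply: contraNneq xr => ->.
Qed.

Lemma derivation_eigen (I : Type) (r : seq I) (F : I -> A) (x : I -> K) :
  (forall i, D (F i) = x i *: F i) ->
  D (\prod_(i <- r) F i) = (\sum_(i <- r) x i) *: \prod_(i <- r) F i.
Proof.
move=> DF; elim: r => [|i r IHr]; first by rewrite !big_nil derivation1 scale0r.
by rewrite !big_cons leibniz IHr DF scalerDl scalerAl scalerAr.
Qed.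

Lemma iter_derivation0 k : iter k D 0 = 0.
Proof. by elim: k => //= k ->; rewrite linear0. Qed.

Lemma iter_derivationD k p q : iter k D (p + q) = iter k D p + iter k D q.
Proof. by elim: k => //= k ->; rewrite linearD. Qed.

(** The Leibniz rule splits off one derivative, which lowers one of the two nilpotency orders; hence
    induction on their sum. *)
Lemma iter_derivationM a b p q :
  iter a.+1 D p = 0 -> iter b.+1 D q = 0 -> iter (a + b).+1 D (p * q) = 0.
Proof.
have [s] := ubnP (a + b); elim: s a b p q => // s IHs a b p q sab pa qb.
rewrite iterSr leibniz iter_derivationD.
have -> : iter (a + b) D (D p * q) = 0.
  case: a pa sab => [|a] pa sab; first by rewrite (pa : D p = 0) mul0r iter_derivation0.
  by apply: IHs; [lia | rewrite -iterSr |].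
case: b qb sab => [|b] qb sab.
  by rewrite (qb : D q = 0) mulr0 iter_derivation0 addr0.
by rewrite add0r addnS; apply: IHs; [lia | | rewrite -iterSr].
Qed.

Lemma iter_derivation_prod (I : Type) (r : seq I) (F : I -> A) (k : I -> nat) :
  (forall i, iter (k i).+1 D (F i) = 0) ->
  iter (\sum_(i <- r) k i)%N.+1 D (\prod_(i <- r) F i) = 0.
Proof.
move=> kF; elim: r => [|i r IHr]; first by rewrite !big_nil /= derivation1.
by rewrite !big_cons iter_derivationM.
Qed.

End Derivations.

(** * The differential operators in word coordinates *)

Section Operators.

Variables (C : numClosedFieldType) (m n : nat).
Implicit Types (z : 'I_n -> C) (p q : {mpoly C[m * n]}).

Fact ez_op_is_linear z i j : linear (@ez_op C m n z i j).
Proof.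
move=> a p q; rewrite /ez_op scaler_sumr -big_split; apply: eq_bigr => x _ /=.
by rewrite mderivD mderivZ mulrDr scalerDr -scalerAr !scalerA mulrC.
Qed.
HB.instance Definition _ z i j :=
  GRing.isLinear.Build C {mpoly C[m * n]} {mpoly C[m * n]} _ (@ez_op C m n z i j)
    (@ez_op_is_linear z i j).

Lemma ez_opM z i j p q : ez_op z i j (p * q) = ez_op z i j p * q + p * ez_op z i j q.
Proof.
rewrite /ez_op big_distrl big_distrr -big_split; apply: eq_bigr => a _ /=.
rewrite mderivM mulrDr scalerDr -!scalerAl -!scalerAr; congr (_ *: _ + _ *: _).
  by rewrite mulrA.
by rewrite mulrCA.
Qed.

Lemma e_opE (i j : 'I_m) p : e_op i j p = ez_op (@one_z C n) i j p.
Proof. by apply: eq_bigr => a _; rewrite scale1r. Qed.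

Lemma mxvec_index_inj (j k : 'I_m) (a b : 'I_n) :
  (mxvec_index j a == mxvec_index k b) = (j == k) && (a == b).
Proof.
by rewrite (inj_eq (@cast_ord_inj _ _ _)) (inj_eq enum_rank_inj) xpair_eqE.
Qed.

Lemma ez_op_yvar z (i j k : 'I_m) a :
  ez_op z i j (yvar C k a) = if k == j then z a *: yvar C i a else 0.
Proof.
rewrite /ez_op (bigD1 a) //= big1 ?addr0 => [|b ba].
  rewrite mderivX mnmE mxvec_index_inj eqxx andbT; case: eqP => [->|_].
    have -> : (U_(mxvec_index j a) - U_(mxvec_index j a) = 0 :> 'X_{1..m * n})%MM.
      by apply/mnmP => x; rewrite !mnmE subnn.
    by rewrite mpolyX0 scale1r mulr1.
  by rewrite scale0r mulr0 scaler0.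
rewrite mderivX mnmE mxvec_index_inj [a == b]eq_sym (negPf ba) andbF.
by rewrite scale0r mulr0 scaler0.
Qed.

(** The map [g] places the letters: [enum_val] for a single block, the identity for all points. *)
Definition yword r (g : 'I_r -> 'I_n) (v : {ffun 'I_r -> 'I_m}) : {mpoly C[m * n]} :=
  \prod_a yvar C (v a) (g a).

Lemma ez_op_yword r (g : 'I_r -> 'I_n) z i j v :
  ez_op z i j (yword g v) = \sum_(a | v a == j) z (g a) *: yword g (upd v a i).
Proof.
rewrite /yword (derivation_prod (ez_opM z i j)) ?index_enum_uniq // [RHS]big_mkcond.
apply: eq_bigr => a _; rewrite /= ez_op_yvar; case: ifP => _; last by rewrite mul0r.
rewrite -scalerAl [in RHS](bigD1 a) //= upd_same; congr (_ *: (_ * _)).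
by apply: eq_bigr => b ba; rewrite upd_other.
Qed.

Definition mpoly_of_word r (g : 'I_r -> 'I_n) (c : {ffun 'I_r -> 'I_m} -> C) :=
  \sum_v c v *: yword g v.

Lemma ez_op_mpoly_of_word r (g : 'I_r -> 'I_n) z i j c :
  ez_op z i j (mpoly_of_word g c) = mpoly_of_word g (opw (fun a => z (g a)) i j c).
Proof.
rewrite raddf_sum /=.
under eq_bigr do rewrite linearZ /= ez_op_yword scaler_sumr.
rewrite (sum_upd_exchange j i (fun a v w => c v *: (z (g a) *: yword g w))).
apply: eq_bigr => v _; rewrite /opw scaler_suml; apply: eq_bigr => a _.
by rewrite scalerA mulrC.
Qed.

Lemma mpoly_of_word0 r (g : 'I_r -> 'I_n) : mpoly_of_word g (fun=> 0) = 0.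
Proof. by rewrite /mpoly_of_word big1 // => v _; rewrite scale0r. Qed.

Definition word_point (w : {ffun 'I_n -> 'I_m}) (k : 'I_(m * n)) : C :=
  [exists a, k == mxvec_index (w a) a]%:R.

Lemma word_pointE w j a : word_point w (mxvec_index j a) = (w a == j)%:R.
Proof.
congr ((nat_of_bool _)%:R); apply/existsP/eqP => [[b]|<-]; last by exists a.
by rewrite mxvec_index_inj => /andP[/eqP-> /eqP->].
Qed.

(* Evaluating at the indicator of w extracts the coefficient of y^w from a
   multilinear polynomial. *)
Definition wcoef p w : C := p.@[word_point w].

Lemma wcoef_yword r (g : 'I_r -> 'I_n) v w :
  wcoef (yword g v) w = [forall a, v a == w (g a)]%:R.
Proof.
rewrite /wcoef /yword rmorph_prod /=.
under eq_bigr do rewrite mevalXU word_pointE.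
have [/forallP H|/forallPn[a na]] := boolP [forall a, v a == w (g a)].
  by rewrite big1 // => a _; rewrite eq_sym H.
by rewrite (bigD1 a) //= eq_sym (negPf na) mul0r.
Qed.

Lemma wcoef_mpoly_of_word r (g : 'I_r -> 'I_n) c w :
  wcoef (mpoly_of_word g c) w = c [ffun a => w (g a)].
Proof.
rewrite /wcoef raddf_sum (bigD1 [ffun a => w (g a)]) //= mevalZ.
rewrite -/(wcoef _ _) wcoef_yword big1 => [|v nv].
  by rewrite (introT forallP) ?mulr1 ?addr0 // => a; rewrite ffunE.
rewrite mevalZ -/(wcoef _ _) wcoef_yword; case: forallP => [H|_]; last by rewrite mulr0.
by case/eqP: nv; apply/ffunP => a; rewrite ffunE (eqP (H a)).
Qed.

(** A multilinear monomial has exactly one variable for each [a], so it is some y^w, which is 1 at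
    the point of [w] and 0 at the other word points. *)
Lemma multilinearE p : multilinear p -> p = mpoly_of_word id (wcoef p).
Proof.
move=> ml; rewrite {1}[p]mpolyE /mpoly_of_word.
have wordP mon : mon \in msupp p -> exists w, 'X_[mon] = yword id w.
  move=> /ml H; have /fin_all_exists[w wP] (a : 'I_n) : exists j, mon (mxvec_index j a) == 1%N.
    apply/existsP; apply: contraT => /existsPn none.
    have [j mj|] := pickP (fun j => mon (mxvec_index j a) != 0%N); last first.
      by move=> z0; have := H a; rewrite big1 // => j _; apply/eqP; rewrite -[_ == _]negbK z0.
    by have := H a; rewrite (bigD1 j) //= => E; have := none j; have := mj; lia.
  exists [ffun a => w a]; rewrite /yword.
  have XS := big_morph (fun k : 'X_{1..m * n} => 'X_[k] : {mpoly C[m * n]})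
    (@mpolyXD _ _) (@mpolyX0 _ _).
  rewrite -(XS _ (index_enum 'I_n) predT (fun a => U_(mxvec_index ([ffun a => w a] a) a)%MM)).
  congr 'X_[_]; apply/mnmP => k; case/mxvec_indexP: k => j b.
  rewrite mnm_sumE (bigD1 b) //= big1 => [|a ab]; last first.
    by rewrite mnmE mxvec_index_inj (negPf ab) andbF.
  rewrite mnmE mxvec_index_inj eqxx andbT addn0 ffunE.
  have := H b; rewrite (bigD1 (w b)) //= (eqP (wP b)) => Hb.
  have [<-|jw] := eqVneq (w b) j; first by rewrite (eqP (wP b)).
  move: Hb; rewrite (bigD1 j) //=; last by rewrite eq_sym.
  by lia.
have XE mon : mon \in msupp p -> 'X_[mon] = mpoly_of_word id (wcoef 'X_[mon]).
  move=> /wordP[w ->]; rewrite /mpoly_of_word (bigD1 w) //= big1 => [|v vw].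
    by rewrite wcoef_yword (introT forallP) ?scale1r ?addr0.
  rewrite wcoef_yword; case: forallP => [E|_]; last by rewrite scale0r.
  by case/eqP: vw; apply/ffunP => a; apply/esym/eqP/E.
rewrite big_seq (eq_bigr (fun mon => \sum_v (p@_mon * wcoef 'X_[mon] v) *: yword id v)).
  rewrite exchange_big; apply: eq_bigr => v _ /=.
  rewrite -scaler_suml -big_seq; congr (_ *: _).
  rewrite [in RHS]/wcoef [p in RHS]mpolyE raddf_sum /=.
  by apply: eq_bigr => mon _; rewrite mevalZ.
move=> mon /XE E; rewrite {1}E /mpoly_of_word scaler_sumr.
by apply: eq_bigr => v _; rewrite scalerA.
Qed.

(* Multidegree of a polynomial with respect to the groups of variables
   y_a^(1), ..., y_a^(m). *)
Definition multidegree (d : 'I_n -> nat) p : Prop :=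
  forall mon, mon \in msupp p -> forall a : 'I_n, (\sum_(j < m) mon (mxvec_index j a))%N = d a.

Lemma multidegree1 : multidegree (fun=> 0%N) 1.
Proof.
move=> mon; rewrite msupp1 inE => /eqP-> a.
by rewrite big1 // => j _; rewrite mnmE.
Qed.

Lemma multidegreeM d e p q : multidegree d p -> multidegree e q ->
  multidegree (fun a => (d a + e a)%N) (p * q).
Proof.
move=> dp eq mon /msuppM_le /allpairsP[[m1 m2] /= [m1p m2q ->]] a.
by rewrite -(dp _ m1p) -(eq _ m2q) -big_split; apply: eq_bigr => j _; rewrite mnmE.
Qed.

Lemma multidegree_prod (I : Type) (r : seq I) d (F : I -> {mpoly C[m * n]}) :
  (forall i, multidegree (d i) (F i)) ->
  multidegree (fun a => (\sum_(i <- r) d i a)%N) (\prod_(i <- r) F i).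
Proof.
move=> dF; elim: r => [|i r IHr].
  rewrite big_nil => mon /multidegree1 H a; by rewrite H big_nil.
rewrite big_cons => mon /(multidegreeM (dF i) IHr) H a; by rewrite H big_cons.
Qed.

Lemma multidegree_sum (I : finType) d (F : I -> {mpoly C[m * n]}) :
  (forall i, multidegree d (F i)) -> multidegree d (\sum_i F i).
Proof.
move=> dF mon /msupp_sum_le /flattenP[s /mapP[i _ ->]]; exact: dF.
Qed.

Lemma multidegreeZ d x p : multidegree d p -> multidegree d (x *: p).
Proof. by move=> dp mon /msuppZ_le /dp. Qed.

Lemma multidegree_yvar (j : 'I_m) (a : 'I_n) :
  multidegree (fun b => (b == a : nat)) (yvar C j a).
Proof.
move=> mon; rewrite msuppX inE => /eqP-> b.
rewrite (bigD1 j) //= big1 => [|k kj]; rewrite mnmE mxvec_index_inj.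
  by rewrite eqxx addn0 eq_sym.
by rewrite eq_sym (negPf kj).
Qed.

Lemma multidegree_mpoly_of_word r (g : 'I_r -> 'I_n) c :
  multidegree (fun b => (\sum_a (b == g a))%N) (mpoly_of_word g c).
Proof.
apply: multidegree_sum => v; apply/multidegreeZ/multidegree_prod => a.
exact: multidegree_yvar.
Qed.

End Operators.

Section LocalizationPolynomials.

Variables (C : numClosedFieldType) (m : nat).
Hypothesis m_gt0 : (0 < m)%N.

Lemma Pfun_words (A : comAlgType C) r (y : 'I_m -> 'I_r -> A) (z : 'I_r -> C) (mu : m.-tuple nat) :
  Pfun y z mu = \sum_v pcoef z (tnth mu) v *: \prod_a y (v a) a.
Proof.
pose I_of (v : {ffun 'I_r -> 'I_m}) := [ffun j => [set a | v a == j]].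
(* The default letter never occurs when the sets cover all positions. *)
pose w_of (I : {ffun 'I_m -> {set 'I_r}}) : {ffun 'I_r -> 'I_m} :=
  [ffun a => odflt (Ordinal m_gt0) [pick j | a \in I j]].
rewrite /Pfun (reindex_onto I_of w_of) /=; last first.
  move=> I /andP[/andP[/forallP disj /eqP cover] _]; apply/ffunP => j; rewrite ffunE.
  apply/setP => a; rewrite inE ffunE; case: pickP => [k ak|none] /=.
    apply/eqP/idP => [<-//|aj]; apply/eqP; apply: contraT => kj.
    by have /forallP/(_ j)/implyP/(_ kj)/pred0P/(_ a) := disj k; rewrite /= ak aj.
  have : a \in \bigcup_i I i by rewrite cover inE.
  by case/bigcupP => k _; rewrite none.
rewrite [RHS](bigID (has_weight (tnth mu))) /= [X in _ + X]big1 ?addr0; last first.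
  by move=> v /negPf nw; rewrite /pcoef nw scale0r.
apply: eq_big => [v|v wt].
  have -> : w_of (I_of v) == v.
    apply/eqP/ffunP => a; rewrite ffunE; case: pickP => [k|/(_ (v a))]; rewrite ffunE inE ?eqxx //.
    by move/eqP.
  rewrite andbT [X in X && _](_ : _ = true) /=.
    by apply/forallP/has_weightP => H j; [rewrite cnt_card -(eqP (H j)) ffunE | rewrite ffunE -cnt_card H].
  apply/andP; split.
    apply/forallP => i; apply/forallP => j; apply/implyP => ij.
    rewrite -setI_eq0; apply/eqP/setP => a; rewrite !ffunE !inE.
    by case: eqP => // ->; rewrite (negPf ij).
  apply/eqP/setP => a; rewrite inE; apply/bigcupP; exists (v a) => //.
  by rewrite ffunE inE.
rewrite /pcoef; have -> : has_weight (tnth mu) v.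
  move: wt => /andP[/andP[_ /forallP wt] /eqP wv]; apply/has_weightP => j.
  by rewrite cnt_card -(eqP (wt j)) ffunE.
congr (_^-1 *: _).
  rewrite /Rmul /Rword [RHS](partition_big v predT) //=; apply: eq_bigr => i _.
  rewrite [RHS](eq_bigr (fun a => \prod_(j < m | (i < j)%N) \prod_(b | v b == j) (z a - z b))).
    rewrite [RHS]exchange_big; apply: eq_bigr => j _; rewrite /R2 !ffunE.
    apply: eq_big => [a|a _]; first by rewrite inE.
    by apply: eq_bigl => b; rewrite inE.
  move=> a /eqP va; rewrite (partition_big v (fun j : 'I_m => i < j)%N) /= => [|b]; last by rewrite va.
  apply: eq_bigr => j ij; apply: eq_bigl => b; rewrite va.
  by case: eqP => [->|]; rewrite ?ij // andbF.
rewrite [RHS](partition_big v predT) //=; apply: eq_bigr => j _; rewrite ffunE.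
by apply: eq_big => [a|a]; rewrite inE // => /eqP->.
Qed.

Variables (n : nat) (z : 'I_n -> C).

Lemma PsetE (U : {set 'I_n}) (mu : m.-tuple nat) :
  Pset z U mu = mpoly_of_word (fun a : 'I_#|U| => enum_val a)
    (pcoef (fun a : 'I_#|U| => z (enum_val a)) (tnth mu)).
Proof. exact: Pfun_words. Qed.

End LocalizationPolynomials.

(** * The polynomials Q are conformal blocks *)


Section BalancedContent.

Variables (m : nat).
Hypothesis m_gt0 : (0 < m)%N.

Definition bal (r j : nat) : nat := (r %/ m + (j < r %% m))%N.

Lemma tnth_balanced r (j : 'I_m) : tnth (balanced m r) j = bal r j.
Proof. by rewrite tnth_mktuple. Qed.

Lemma balS r j : (j.+1 < m)%N -> (bal r j = bal r j.+1 + (r %% m == j.+1))%N.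
Proof. by move=> jm; rewrite /bal -addnA; congr (_ + _)%N; case: (ltngtP (r %% m) j.+1); lia. Qed.

Lemma bal0 r : (bal r 0 = bal r m.-1 + (r %% m != 0))%N.
Proof. by rewrite /bal -addnA; congr (_ + _)%N; have := ltn_pmod r m_gt0; lia. Qed.

Lemma sum_bal r : (\sum_(j < m) bal r j = r)%N.
Proof.
have [_ + _] := (balancedP r (balanced m r) m_gt0).2 (erefl _).
rewrite sumnE (big_nth 0%N) size_tuple big_mkord => sumr; rewrite -[RHS]sumr.
by apply: eq_bigr => j _; rewrite -tnth_nth tnth_balanced.
Qed.

Lemma bal_succ r (j : 'I_m) : bal r.+1 j = (r %/ m + (j <= r %% m))%N.
Proof.
have lt_rm := ltn_pmod r m_gt0; have lt_jm := ltn_ord j.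
have := divn_eq r m; set q := (r %/ m)%N; set s := (r %% m)%N => rE.
rewrite /bal; have [sm|sm] := ltnP s.+1 m.
  have -> : r.+1 = (q * m + s.+1)%N by rewrite rE addnS.
  by rewrite divnMDl // modnMDl divn_small // modn_small // addn0.
have -> : r.+1 = (q.+1 * m)%N by rewrite rE /s; nia.
rewrite mulnK // modnMl ltn0 addn0 (_ : (j <= s)%N); first by rewrite addn1.
by rewrite -ltnS (leq_trans lt_jm).
Qed.

(** A growing balanced block takes its letters cyclically. *)
Lemma bal_succE r (j : 'I_m) : bal r.+1 j = ((r %% m == j) + bal r j)%N.
Proof.
by rewrite bal_succ /bal addnCA; congr (_ + _)%N; case: ltngtP.
Qed.

Variables (ell : nat) (lam : m.-tuple nat) (s : 'I_ell -> nat).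
Hypotheses (lam_sorted : sorted geq lam) (lam_spread : (spread lam <= ell)%N).

Let N (j : nat) := #|[set i | s i == j %[mod m]]|.

Let N_sum j : (j < m)%N -> N j = (\sum_i (s i %% m == j))%N.
Proof.
move=> jm; rewrite /N -sum1_card big_mkcond; apply: eq_bigr => i _.
by rewrite inE (modn_small jm); case: eqP.
Qed.

Lemma lam_nonincreasing j : (j.+1 < m)%N -> (nth 0 lam j.+1 <= nth 0 lam j)%N.
Proof. by move=> jm; have /(sortedP 0%N) := lam_sorted; apply; rewrite size_tuple. Qed.

Lemma lam_le i j : (i <= j < m)%N -> (nth 0 lam j <= nth 0 lam i)%N.
Proof.
move=> /andP[ij jm]; elim: j ij jm => [|j IHj]; first by rewrite leqn0 => /eqP->.
rewrite leq_eqVlt => /predU1P[->//|ij] jm.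
by rewrite (leq_trans (lam_nonincreasing jm)) // IHj // ltnW.
Qed.

(** Neighbouring parts of a balanced partition differ only for one residue of the size. Together
    with [sum_bal0] this turns contents into counts and back. *)
Lemma sum_balS j : (j.+1 < m)%N ->
  (\sum_i bal (s i) j = \sum_i bal (s i) j.+1 + N j.+1)%N.
Proof.
by move=> jm; rewrite N_sum // -big_split; apply: eq_bigr => i _; rewrite balS.
Qed.

Lemma sum_bal0 : (\sum_i bal (s i) 0 + N 0 = \sum_i bal (s i) m.-1 + ell)%N.
Proof.
rewrite N_sum // -[X in (_ = _ + X)%N](card_ord ell) -sum1_card -!big_split.
apply: eq_big => // i _ /=.
by rewrite bal0 -addnA; congr (_ + _)%N; case: eqP.
Qed.

Lemma counts_of_content : (forall j : 'I_m, \sum_i bal (s i) j = tnth lam j)%N ->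
  forall j : 'I_m, N j = (ext_part ell lam j - ext_part ell lam j.+1)%N.
Proof.
have lt_pm : (m.-1 < m)%N by rewrite prednK.
move=> S [[|j] jm] /=.
  have := sum_bal0; rewrite (S (Ordinal m_gt0)) (S (Ordinal lt_pm)) !(tnth_nth 0%N) /=.
  by lia.
have := sum_balS jm; rewrite (S (Ordinal jm)) (S (Ordinal (ltnW jm))) !(tnth_nth 0%N) /=.
by lia.
Qed.

(** The counts fix the consecutive differences, so the contents differ from lambda by a constant,
    which is 0 by comparing totals. *)
Lemma content_of_counts : (\sum_i s i = sumn lam)%N ->
  (forall j : 'I_m, N j = (ext_part ell lam j - ext_part ell lam j.+1)%N) ->
  forall j : 'I_m, (\sum_i bal (s i) j = tnth lam j)%N.
Proof.
move=> sizes NE.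
have step j : (j < m)%N ->
    (\sum_i bal (s i) j + nth 0 lam 0 = \sum_i bal (s i) 0 + nth 0 lam j)%N.
  elim: j => // j IHj jm; have := sum_balS jm; have := IHj (ltnW jm).
  by rewrite (NE (Ordinal jm)) /=; have := lam_nonincreasing jm; lia.
have E : (\sum_(j < m) (\sum_i bal (s i) j + nth 0 lam 0) =
          \sum_(j < m) (\sum_i bal (s i) 0 + nth 0 lam j))%N.
  by apply: eq_bigr => j _; apply: step.
rewrite [LHS]big_split [RHS]big_split /= exchange_big /= in E.
rewrite (eq_bigr s) in E; last by move=> i _; rewrite sum_bal.
have lamE : (\sum_(j < m) nth 0 lam j = sumn lam)%N.
  by rewrite sumnE [RHS](big_nth 0%N) size_tuple big_mkord.
rewrite !sum_nat_const card_ord sizes lamE [RHS]addnC in E.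
move/addnI/eqP: E; rewrite eqn_pmul2l // => /eqP E j.
by have := step j (ltn_ord j); rewrite (tnth_nth 0%N) E addnC => /addnI.
Qed.

End BalancedContent.

Section Containment.

Variables (C : numClosedFieldType) (m n : nat).
Hypothesis m_gt0 : (0 < m)%N.
Variable z : 'I_n -> C.
Hypothesis z_inj : injective z.

Section OneSet.
Variable (W : {set 'I_n}).
Let mu : m.-tuple nat := balanced m #|W|.
Let g (a : 'I_#|W|) := enum_val a.
Let zW (a : 'I_#|W|) := z (g a).

Let zW_inj : injective zW.
Proof. by move=> a b /z_inj/enum_val_inj. Qed.

Let mu_le (i j : 'I_m) : (i < j)%N -> (tnth mu j <= tnth mu i)%N.
Proof. by move=> ij; rewrite !tnth_balanced // /bal leq_add2l; case: (ltnP j); lia. Qed.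

Lemma e_op_Pset (i j : 'I_m) : (i < j)%N -> e_op i j (Pset z W mu) = 0.
Proof.
move=> ij; rewrite e_opE PsetE // ez_op_mpoly_of_word.
rewrite [opw _ _ _ _](_ : _ = fun=> 0) ?mpoly_of_word0 //; apply: funext => v.
rewrite (_ : (fun a => @one_z C n (g a)) = fun a => (1 : {poly C}).[zW a]); last first.
  by apply: funext => a; rewrite hornerE.
by rewrite (opw_pcoef_small zW_inj) // size_poly1 addnC leq_add2r mu_le.
Qed.

Lemma e_op_Pset_diag (i : 'I_m) : e_op i i (Pset z W mu) = (tnth mu i)%:R *: Pset z W mu.
Proof.
rewrite e_opE PsetE // ez_op_mpoly_of_word /mpoly_of_word scaler_sumr.
apply: eq_bigr => v _; rewrite scalerA; congr (_ *: _).
rewrite /opw (eq_bigr (fun=> pcoef zW (tnth mu) v)) => [|a /eqP va]; last first.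
  by rewrite mul1r -[in upd v a i]va upd_id.
rewrite sumr_const -[LHS]mulr_natl; rewrite /pcoef; case: has_weightP => [wt|_]; last by rewrite !mulr0.
by rewrite -wt cnt_card cardsE.
Qed.

(** The first and last part agree exactly if [m] divides the size, where [opw_pcoef_square] applies;
    otherwise they differ by one, enough for [opw_pcoef_small] with ['X]. *)
Lemma ez_op_Pset (i j : 'I_m) : i = 0%N :> nat -> j = m.-1 :> nat -> (i < j)%N ->
  iter (#|W| %% m == 0)%N.+1 (ez_op z i j) (Pset z W mu) = 0.
Proof.
move=> i0 jm ij; rewrite PsetE //.
have muE : (tnth mu i = tnth mu j + (#|W| %% m != 0)%N)%N.
  by rewrite !tnth_balanced i0 jm bal0.
have [W0|W0] := boolP (_ == _); rewrite /= !ez_op_mpoly_of_word.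
  by rewrite (opw_pcoef_square zW_inj) ?mpoly_of_word0 // muE W0 addn0.
rewrite [opw _ _ _ _](_ : _ = fun=> 0) ?mpoly_of_word0 //; apply: funext => v.
rewrite [X in opw X](_ : _ = fun a => ('X : {poly C}).[zW a]); last first.
  by apply: funext => a; rewrite hornerX.
by rewrite (opw_pcoef_small zW_inj) // size_polyX muE W0; lia.
Qed.
End OneSet.

Lemma set_partition_count k (V : {ffun 'I_k -> {set 'I_n}}) a : set_partition V ->
  (\sum_i (a \in V i) = 1)%N.
Proof.
move=> /andP[/forallP disj /eqP cover].
have /bigcupP[i _ ai] : a \in \bigcup_i V i by rewrite cover inE.
rewrite (bigD1 i) //= ai big1 // => j ji; apply/eqP; rewrite eqb0.
apply: contraTN ai => aj.
by have /forallP/(_ i)/implyP/(_ ji)/pred0P/(_ a) := disj j; rewrite /= aj /= => ->.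
Qed.

(** Weights and nilpotency orders add up over the factors. Admissibility at j = 0 says that lambda_0
    - lambda_1 = ell - d(lambda) factors need a second application. *)
Lemma CB_Qfun ell (lam : m.-tuple nat) (V : {ffun 'I_ell -> {set 'I_n}}) :
  (1 < m)%N -> sorted geq lam -> sumn lam = n -> (spread lam <= ell)%N ->
  admissible lam V -> CB z ell lam (Qfun m z V).
Proof.
move=> m_gt1 lam_sorted lam_sum lam_spread /andP[Vpart /forallP Vcount].
have sizes : (\sum_i #|V i| = sumn lam)%N.
  rewrite lam_sum -[RHS]card_ord -sum1_card.
  under eq_bigr do rewrite -sum1_card big_mkcond.
  rewrite exchange_big /=; apply: eq_big => // a _; rewrite -[RHS](set_partition_count a Vpart).
  by apply: eq_bigr => i _; case: (_ \in _).
have content := content_of_counts m_gt0 lam_sorted lam_spread sizes (fun j => eqP (Vcount j)).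
split; first split.
- have : multidegree (fun a => \sum_i \sum_(b < #|V i|) (a == enum_val b))%N (Qfun m z V).
    by apply: (multidegree_prod (d := fun i a => \sum_(b < #|V i|) (a == enum_val b))%N) => i;
      rewrite PsetE //; apply: multidegree_mpoly_of_word.
  move=> md mon /md H a; rewrite H -[RHS](set_partition_count a Vpart).
  apply: eq_bigr => i _; rewrite -(big_enum_val (fun b => nat_of_bool (a == b))) /=.
  case aV: (a \in V i).
    by rewrite (bigD1 a) //= eqxx big1 // => b /andP[_ ba]; rewrite eq_sym (negPf ba).
  by rewrite big1 // => b bV; case: eqP => // ab; rewrite -ab aV in bV.
- move=> i j ij; rewrite e_opE.
  have D0 k : ez_op (@one_z C n) i j (Pset z (V k) (balanced m #|V k|)) =
      0 *: Pset z (V k) (balanced m #|V k|).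
    by rewrite -e_opE e_op_Pset // scale0r.
  have := derivation_eigen (ez_opM (@one_z C n) i j) (index_enum 'I_ell) D0.
  by rewrite big1_eq scale0r; apply.
- move=> i; rewrite e_opE.
  have Di k : ez_op (@one_z C n) i i (Pset z (V k) (balanced m #|V k|)) =
      (bal m #|V k| i)%:R *: Pset z (V k) (balanced m #|V k|).
    by rewrite -e_opE e_op_Pset_diag tnth_balanced.
  have := derivation_eigen (ez_opM (@one_z C n) i i) (index_enum 'I_ell) Di.
  by rewrite -natr_sum content; apply.
move=> i j i0 jm; have ij : (i < j)%N by rewrite i0 jm; lia.
have := iter_derivation_prod (ez_opM z i j) (index_enum 'I_ell)
  (fun k => ez_op_Pset (V k) i0 jm ij).
rewrite (_ : \sum_(k <- _) _ = ell - spread lam)%N //.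
have := Vcount (Ordinal m_gt0) => /eqP; rewrite /= => E.
have -> : (ell - spread lam = ell + nth 0 lam m.-1 - nth 0 lam 0)%N.
  by rewrite /spread; have := @lam_le m lam lam_sorted 0 m.-1; rewrite prednK //= leqnn => /(_ isT); lia.
rewrite -E -sum1_card [RHS]big_mkcond; apply: eq_bigr => k _.
by rewrite inE mod0n; case: eqP.
Qed.

End Containment.

(** * Restricted words and chains *)


Section Chains.

Variables (m ell : nat).
Hypothesis m_gt1 : (1 < m)%N.

Let m_gt0 : (0 < m)%N. Proof. exact: ltnW. Qed.

(* u a is the block containing the letter at position a. *)
Definition bcnt n (w : {ffun 'I_n -> 'I_m}) (u : {ffun 'I_n -> 'I_ell}) i j : nat :=
  (\sum_a ((u a == i) && (w a == j)))%N.

(** For distinct points, this singles out the words whose monomials occur in Q (see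
    [wcoef_Qfun]). *)
Definition balanced_blocks n (w : {ffun 'I_n -> 'I_m}) (u : {ffun 'I_n -> 'I_ell}) : bool :=
  [forall i, forall j, bcnt w u i j == bal m (cnt u i) j].

Lemma balanced_blocksP n (w : {ffun 'I_n -> 'I_m}) u :
  reflect (forall i j, bcnt w u i j = bal m (cnt u i) j) (balanced_blocks w u).
Proof.
apply: (iffP forallP) => [H i j|H i]; first by have /forallP/(_ j)/eqP := H i.
by apply/forallP => j; rewrite H.
Qed.

(** Balance of every suffix makes the letters of each block cycle when read from the end. *)
Fixpoint chained n : {ffun 'I_n -> 'I_m} -> {ffun 'I_n -> 'I_ell} -> bool :=
  if n is n'.+1 then
    fun w u => balanced_blocks w u && chained (behw w) (behw u)
  else fun _ _ => true.

Lemma chained_balanced n (w : {ffun 'I_n -> 'I_m}) u : chained w u -> balanced_blocks w u.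
Proof.
case: n w u => [|n] w u /=; last by case/andP.
move=> _; apply/balanced_blocksP => i j.
by rewrite /bcnt /cnt !big_ord0 /bal div0n mod0n.
Qed.

Lemma bcnt_cons n j (v : {ffun 'I_n -> 'I_m}) i (u : {ffun 'I_n -> 'I_ell}) k l :
  bcnt (consw j v) (consw i u) k l = ((i == k) && (j == l) + bcnt v u k l)%N.
Proof.
rewrite /bcnt big_ord_recl !consw0; congr (_ + _)%N.
by apply: eq_bigr => a _; rewrite !conswS.
Qed.

Lemma cnt_bcnt n (w : {ffun 'I_n -> 'I_m}) (u : {ffun 'I_n -> 'I_ell}) j :
  cnt w j = (\sum_i bcnt w u i j)%N.
Proof.
rewrite /bcnt exchange_big; apply: eq_bigr => a _.
by rewrite (bigD1 (u a)) //= eqxx big1 ?addn0 // => i; rewrite eq_sym => /negPf->.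
Qed.

(* A letter j extends a block whose size is j modulo m; the alcove condition says
   exactly that such a block exists. *)
Lemma exists_chained n (w : {ffun 'I_n -> 'I_m}) :
  restricted ell w -> exists u, chained w u.
Proof.
elim: n w => [|n IHn] w; first by exists (ffun0 (card_ord 0)).
rewrite -(consw_beh w); move: (w ord0) (behw w) => j v /= /andP[/alcoveP alc].
rewrite behw_cons => /IHn[u vu]; have /balanced_blocksP bb := chained_balanced vu.
have S k : cnt v k = (\sum_i bal m (cnt u i) k)%N.
  by rewrite (cnt_bcnt v u); apply: eq_bigr => i _.
have : (0 < #|[set i | cnt u i == j %[mod m]]|)%N.
  have lt_pm : (m.-1 < m)%N by rewrite prednK.
  case: j alc => -[|j] jm alc /=.
    have := sum_bal0 m_gt0 (fun i => cnt u i).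
    rewrite -(S (Ordinal jm)) -(S (Ordinal lt_pm)).
    have [_] := alc (Ordinal jm) (Ordinal lt_pm) isT.
    rewrite !cnt_cons eqxx -!val_eqE /= (_ : (0 == m.-1) = false)%N; first by lia.
    by case: (m) m_gt1 => [|[]].
  have := sum_balS m_gt0 (fun i => cnt u i) jm.
  rewrite -(S (Ordinal jm)) -(S (Ordinal (ltnW jm))).
  have [+ _] := alc (Ordinal (ltnW jm)) (Ordinal jm) (leqnSn _).
  rewrite !cnt_cons -!val_eqE /= eqxx (gtn_eqF (ltnSn j)).
  by lia.
case/card_gt0P => i; rewrite inE (modn_small (ltn_ord j)) => /eqP ij.
exists (consw i u); rewrite /= !behw_cons vu andbT; apply/balanced_blocksP => k l.
rewrite bcnt_cons cnt_cons bb; case: (i =P k) => [<-|_] //=.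
by rewrite add1n bal_succE // ij.
Qed.

Variable B : nat.

(** The pairs whose difference occurs in the denominator of the coefficient of y^w in Q. *)
Definition clash n (w : {ffun 'I_n -> 'I_m}) (u : {ffun 'I_n -> 'I_ell}) (a b : 'I_n) : bool :=
  (u a == u b) && (w a != w b).

Definition defect n (w : {ffun 'I_n -> 'I_m}) (u : {ffun 'I_n -> 'I_ell}) (a : 'I_n) : nat :=
  (\sum_(b < n | a < b) clash w u a b)%N.

(** The factor [m] leaves room for a tie-breaker that depends on the word alone and is smaller for
    larger letters. *)
Definition digit n (w : {ffun 'I_n -> 'I_m}) (u : {ffun 'I_n -> 'I_ell}) (a : 'I_n) : nat :=
  (m * defect w u a + (m.-1 - w a))%N.

(* Up to a factor depending only on u and a factor depending only on w, the
   coefficient of y^w in Q has order s^(height w u) along the curve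
   z_a = s^-(m B^(n-1-a)). *)
Definition height n (w : {ffun 'I_n -> 'I_m}) (u : {ffun 'I_n -> 'I_ell}) : nat :=
  (\sum_(a < n) B ^ (n.-1 - a) * digit w u a)%N.

Lemma defect_cons0 n j (v : {ffun 'I_n -> 'I_m}) i u :
  (defect (consw j v) (consw i u) ord0 + bcnt v u i j = cnt u i)%N.
Proof.
rewrite /defect big_mkcond big_ord_recl ltnn /= add0n /bcnt -big_split.
apply: eq_bigr => b _; rewrite /clash !consw0 !conswS /= eq_sym [j == v b]eq_sym.
by case: (u b == i); case: (v b == j).
Qed.

Lemma defect_consS n j (v : {ffun 'I_n -> 'I_m}) i u a :
  defect (consw j v) (consw i u) (lift ord0 a) = defect v u a.
Proof.
rewrite /defect big_mkcond big_ord_recl ltn0 /= add0n [RHS]big_mkcond.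
by apply: eq_bigr => b _; rewrite /clash !conswS.
Qed.

Lemma height_cons n j (v : {ffun 'I_n -> 'I_m}) i u :
  height (consw j v) (consw i u) =
  (B ^ n * digit (consw j v) (consw i u) ord0 + height v u)%N.
Proof.
rewrite /height big_ord_recl subn0; congr (_ + _)%N; apply: eq_bigr => a _.
rewrite /digit defect_consS conswS; congr (B ^ _ * _)%N.
by rewrite /= /bump; case: (n) a => [[]|k a]; rewrite //= add1n subSS.
Qed.

Lemma digit_lt n (w : {ffun 'I_n -> 'I_m}) u a : (digit w u a < m * n)%N.
Proof.
have wm := ltn_ord (w a).
have : (defect w u a < n)%N.
  rewrite /defect; apply: (@leq_ltn_trans (\sum_(b < n | a < b) 1)%N).
    by apply: leq_sum => b _; apply: leq_b1.
  rewrite -[X in (_ < X)%N](card_ord n) -sum1_card [X in (_ < X)%N](bigD1 a) //= add1n ltnS.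
  rewrite big_mkcond [X in (_ <= X)%N]big_mkcond; apply: leq_sum => b _.
  by case: ltnP => // ab; rewrite neq_ltn ab orbT.
by rewrite /digit; nia.
Qed.

Lemma height_lt n (w : {ffun 'I_n -> 'I_m}) u : (m * n <= B)%N -> (height w u < B ^ n)%N.
Proof.
elim: n w u => [|n IHn] w u mnB; first by rewrite /height big_ord0.
rewrite -(consw_beh w) -(consw_beh u) height_cons expnS mulnC.
set d := digit _ _ _; have dB : (d < B)%N by apply: leq_trans mnB; apply: digit_lt.
have := IHn (behw w) (behw u); set h := height _ _ => /(_ _) hB.
have {hB} : (h < B ^ n)%N by apply: hB; nia.
by move: (B ^ n)%N => X; nia.
Qed.

(** The leading digit decides. For the first position, the cyclic letter [j] and all smaller letters
    give the same defect, larger ones one more; among the former [j] has the smallest tie-breaker.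
    If the first letters agree, compare the tails. *)
Lemma height_min n (w w' : {ffun 'I_n -> 'I_m}) u : (m * n <= B)%N ->
  chained w u -> balanced_blocks w' u -> w' != w -> (height w u < height w' u)%N.
Proof.
elim: n w w' u => [|n IHn] w w' u mnB.
  by move=> _ _ /eqP[]; apply/ffunP => -[].
rewrite -(consw_beh w) -(consw_beh w') -(consw_beh u).
move: (w ord0) (behw w) (w' ord0) (behw w') (u ord0) (behw u) => j v j' v' i {}u /=.
move=> /andP[bb]; rewrite !behw_cons => vu bb'; rewrite !height_cons.
have /balanced_blocksP bv := chained_balanced vu.
move/balanced_blocksP: bb => bb; move/balanced_blocksP: bb' => bb'.
have jE : (cnt u i %% m = j)%N.
  have := bb i j; rewrite bcnt_cons !eqxx bv cnt_cons eqxx add1n bal_succE //.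
  by case: eqP => // _; lia.
have dE k x : bcnt (consw k x) (consw i u) i k = bal m (cnt (consw i u) i) k ->
    (defect (consw k x) (consw i u) ord0 + (cnt u i %/ m + (k <= j)) = (cnt u i).+1)%N.
  rewrite bcnt_cons cnt_cons !eqxx !add1n bal_succ // jE => <-.
  by rewrite addnS defect_cons0.
have := dE j v (bb i j); have := dE j' v' (bb' i j'); rewrite leqnn.
rewrite /digit !consw0; set D' := defect _ _ _; set D := defect _ _ _ => D'E DE.
have [jj'|jj' _] := eqVneq j' j.
  rewrite {}jj' leqnn in bb' D' D'E * => neq.
  have -> : D' = D by lia.
  rewrite ltn_add2l IHn //; first by nia.
    apply/balanced_blocksP => k l; apply/eqP; rewrite -bv -(eqn_add2l ((i == k) && (j == l))).
    by rewrite -!bcnt_cons bb bb'.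
  by apply: contraNneq neq => ->.
(* The lower digits of [w] stay below one unit of the leading digit. *)
have hlt : (height v u < B ^ n)%N by apply: height_lt; nia.
have : (m * D + (m.-1 - j) < m * D' + (m.-1 - j'))%N.
  have lt_jm := ltn_ord j; have lt_j'm := ltn_ord j'.
  have nj : j' <> j :> nat by move/val_inj/eqP; rewrite (negPf jj').
  case: (leqP j' j) D'E => jj D'E.
    have -> : D' = D by lia.
    lia.
  have -> : D' = D.+1 by lia.
  by rewrite mulnS; lia.
set x := (_ + _)%N; set x' := (_ + _)%N => xx'.
apply: (@leq_trans (B ^ n * x.+1)); first by rewrite mulnS addnC ltn_add2r.
by rewrite (leq_trans (leq_mul (leqnn _) xx')) // leq_addr.
Qed.

End Chains.

(** * The matrix of coefficients *)


Section Entries.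

Variables (C : numClosedFieldType) (m ell n : nat).
Hypothesis m_gt1 : (1 < m)%N.
Implicit Types (z : 'I_n -> C) (w : {ffun 'I_n -> 'I_m}) (u : {ffun 'I_n -> 'I_ell}).

Let m_gt0 : (0 < m)%N. Proof. exact: ltnW. Qed.

Definition orient w (a b : 'I_n) : C := if (w a < w b)%N then 1 else -1.

(* The coefficient of y^w in Q, cleared of denominators by the product of all
   z_a - z_b with a < b. *)
Definition entry z w u : C :=
  (balanced_blocks w u)%:R * \prod_(a < n) \prod_(b < n | (a < b)%N)
    (if clash w u a b then orient w a b else z a - z b).

Definition vand z : C := \prod_(a < n) \prod_(b < n | (a < b)%N) (z a - z b).

Lemma vand_neq0 z : injective z -> vand z != 0.
Proof.
move=> z_inj; apply/prodf_neq0 => a _; apply/prodf_neq0 => b ab; rewrite subr_eq0.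
by apply: contraTneq ab => /z_inj->; rewrite ltnn.
Qed.

Definition blocks u : {ffun 'I_ell -> {set 'I_n}} := [ffun i => [set a | u a == i]].

Lemma card_blocks u i : #|blocks u i| = cnt u i.
Proof. by rewrite cnt_card ffunE. Qed.

Lemma set_partition_blocks u : set_partition (blocks u).
Proof.
apply/andP; split.
  apply/forallP => i; apply/forallP => j; apply/implyP => ij.
  rewrite -setI_eq0; apply/eqP/setP => a; rewrite !ffunE !inE.
  by case: eqP => // ->; rewrite (negPf ij).
apply/eqP/setP => a; rewrite inE; apply/bigcupP; exists (u a) => //.
by rewrite ffunE inE.
Qed.

Lemma wcoef_Pset z w (W : {set 'I_n}) mu :
  wcoef (Pset z W mu) w =
  ([forall j, (\sum_(a in W) (w a == j) == tnth mu j)%N])%:R *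
    (\prod_(a in W) \prod_(b in W | (w a < w b)%N) (z a - z b))^-1.
Proof.
rewrite PsetE // wcoef_mpoly_of_word /pcoef.
have -> : has_weight (tnth mu) [ffun a : 'I_#|W| => w (enum_val a)] =
    [forall j, (\sum_(a in W) (w a == j) == tnth mu j)%N].
  apply: eq_forallb => j; congr (_ == _); rewrite big_enum_val /cnt.
  by apply: eq_bigr => a _; rewrite ffunE.
case: ifP => _; last by rewrite mul0r.
rewrite mul1r; congr (_^-1); rewrite big_enum_val /Rword; apply: eq_bigr => a _.
rewrite [LHS]big_mkcond big_mkcondr [RHS]big_enum_val; apply: eq_bigr => b _.
by rewrite !ffunE.
Qed.

(** The denominator contains each clashing pair once, up to orientation; [vand] cancels these and
    leaves the differences of the other pairs. *)
Lemma wcoef_Qfun z w u : injective z ->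
  vand z * wcoef (Qfun m z (blocks u)) w = entry z w u.
Proof.
move=> z_inj.
have -> : wcoef (Qfun m z (blocks u)) w = (balanced_blocks w u)%:R *
    (\prod_a \prod_(b | (u a == u b) && (w a < w b)%N) (z a - z b))^-1.
  rewrite /wcoef rmorph_prod /=.
  under eq_bigr do rewrite -/(wcoef _ _) wcoef_Pset.
  rewrite big_split /= prodfV; congr (_ * _^-1).
    have E i : [forall j, (\sum_(a in blocks u i) (w a == j) == tnth (balanced m #|blocks u i|) j)%N]
      = [forall j, bcnt w u i j == bal m (cnt u i) j].
      apply: eq_forallb => j; rewrite tnth_balanced card_blocks; congr (_ == _).
      rewrite /bcnt big_mkcond; apply: eq_bigr => a _; rewrite ffunE inE.
      by case: (u a == i).
    under eq_bigr do rewrite E.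
    rewrite /balanced_blocks; case: forallP => [H|/forallP/forallPn[i ni]].
      by rewrite big1 // => i _; rewrite H.
    by rewrite (bigD1 i) //= (negPf ni) mul0r.
  rewrite [RHS](partition_big u predT) //=; apply: eq_bigr => i _.
  apply: eq_big => [a|a]; rewrite ffunE inE // => /eqP->.
  by apply: eq_bigl => b; rewrite inE eq_sym.
rewrite /entry mulrCA; congr (_ * _).
have -> : \prod_a \prod_(b | (u a == u b) && (w a < w b)%N) (z a - z b) =
    \prod_(a < n) \prod_(b < n | (a < b)%N)
      (if clash w u a b then orient w a b * (z a - z b) else 1).
  pose F a b := if (u a == u b) && (w a < w b)%N then z a - z b else 1.
  have -> : \prod_a \prod_(b | (u a == u b) && (w a < w b)%N) (z a - z b) =
      \prod_(a < n) \prod_(b < n | (a < b)%N) F a b * \prod_(b < n) \prod_(a < n | (b < a)%N) F a b.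
    rewrite [X in _ * X](exchange_big_dep predT) //= -big_split; apply: eq_bigr => a _ /=.
    rewrite big_mkcond (bigID (fun b : 'I_n => a < b)%N) /=; congr (_ * _).
    rewrite (bigD1 a) ?ltnn //= andbF mul1r; apply: eq_bigl => b.
    by rewrite -leqNgt ltn_neqAle andbC.
  rewrite -big_split; apply: eq_bigr => a _; rewrite -big_split; apply: eq_bigr => b ab /=.
  rewrite /F /clash /orient eq_sym; case: (u b == u a) => /=; last by rewrite mulr1.
  rewrite -val_eqE /=; case: ltngtP => _ /=; rewrite ?mulr1 ?mul1r //.
  by rewrite mulN1r opprB.
rewrite -prodfV -big_split; apply: eq_bigr => a _.
rewrite -prodfV -big_split; apply: eq_bigr => b ab /=.
have nz : z a - z b != 0.
  by rewrite subr_eq0; apply: contraTneq ab => /z_inj->; rewrite ltnn.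
case: ifP => _; last by rewrite invr1 mulr1.
rewrite invfM mulrCA divff // mulr1 /orient; case: ifP; rewrite ?invr1 // => _.
by rewrite invrN1.
Qed.

Definition entry_poly w u : {mpoly C[n]} :=
  (balanced_blocks w u)%:R * \prod_(a < n) \prod_(b < n | (a < b)%N)
    (if clash w u a b then (orient w a b)%:MP else 'X_a - 'X_b).

Lemma entry_polyE z w u : (entry_poly w u).@[z] = entry z w u.
Proof.
rewrite /entry_poly /entry mevalM rmorph_nat rmorph_prod; congr (_ * _).
apply: eq_bigr => a _ /=; rewrite rmorph_prod; apply: eq_bigr => b _ /=.
by case: ifP => _; rewrite ?mevalC // mevalB !mevalXU.
Qed.

(** Exceeds all digits by [digit_lt], and is at least 2, so that the exponents [f] strictly
    decrease. *)
Let B := (m * n).+2.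
Let f (a : 'I_n) : nat := (B ^ (n.-1 - a))%N.

Let f_lt (a b : 'I_n) : (a < b)%N -> (f b < f a)%N.
Proof.
by move=> ab; rewrite ltn_exp2l //; have := ltn_ord b; lia.
Qed.

(* The entry along the curve z_a = s^-(m f a), divided by its leading power of s
   for the reference word w0. *)
Definition curve_entry (s : C) w0 w u : C :=
  (balanced_blocks w u)%:R * s ^+ (height B w u - height B w0 u) *
  \prod_(a < n) \prod_(b < n | (a < b)%N)
    (if clash w u a b then orient w a b else 1 - s ^+ (m * f a - m * f b)).

Definition curve (s : C) : 'I_n -> C := fun a => s ^- (m * f a).

(** The tie-breaker part of [height], realised by rescaling the row of [w]. *)
Definition cofactor w : nat := (\sum_(a < n) f a * (m.-1 - w a))%N.

Definition scale (s : C) : C := \prod_(a < n) \prod_(b < n | (a < b)%N) s ^- (m * f a).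

(** Every z_a - z_b is z_a times 1 - s^k with k positive. A clash lacks the factor z_a, which
    amounts to s^(m f a); these powers make up the defect part of the height. *)
Lemma entry_curve s w0 w u : s != 0 -> chained w0 u ->
  s ^+ cofactor w * entry (curve s) w u =
  scale s * s ^+ height B w0 u * curve_entry s w0 w u.
Proof.
move=> s0 w0u; rewrite /entry /curve_entry.
have [bb|_] := boolP (balanced_blocks w u); last by rewrite !mul0r !mulr0.
rewrite !mul1r [RHS]mulrA -[scale s * _ * _]mulrA -exprD subnKC; last first.
  have [->//|nw] := eqVneq w w0.
  by apply/ltnW/height_min => //; rewrite /B; lia.
have -> : \prod_(a < n) \prod_(b < n | (a < b)%N)
    (if clash w u a b then orient w a b else curve s a - curve s b) =
  scale s * s ^+ (\sum_(a < n) f a * (m * defect w u a))%N * \prod_(a < n) \prod_(b < n | (a < b)%N)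
    (if clash w u a b then orient w a b else 1 - s ^+ (m * f a - m * f b)).
  rewrite /scale expr_sum -!big_split; apply: eq_bigr => a _ /=.
  rewrite mulnCA /defect mulnA big_distrr expr_sum -!big_split /=; apply: eq_bigr => b ab.
  have ffab := f_lt ab; have sfa : s ^+ (m * f a) != 0 by rewrite expf_neq0.
  case: (clash w u a b); first by rewrite muln1 mulVf // mul1r.
  rewrite muln0 expr0 mulr1 mulrBr mulr1; congr (_ - _).
  rewrite /curve -{1}(@subnK (m * f b) (m * f a)) ?leq_mul2l ?(ltnW ffab) ?orbT //.
  by rewrite exprD invfM mulrAC mulVf ?mul1r // expf_neq0.
rewrite !mulrA; congr (_ * _); rewrite [s ^+ _ * scale s]mulrC -mulrA -exprD; congr (_ * _ ^+ _).
by rewrite /cofactor -big_split; apply: eq_bigr => a _; rewrite /digit mulnDr addnC.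
Qed.

(** Off the diagonal [height_min] leaves a positive power of s; on it every factor is 1 or -1 at s =
    0. *)
Lemma curve_entry0 w0 w u : chained w0 u ->
  (curve_entry 0 w0 w u != 0) = (w == w0).
Proof.
move=> w0u; rewrite /curve_entry.
have [->|nw] := eqVneq w w0; last first.
  apply/negbF/eqP; have [bb|_] := boolP (balanced_blocks w u); last by rewrite !mul0r.
  rewrite mul1r expr0n (_ : (_ == 0)%N = false) ?mul0r //.
  by apply/negbTE; rewrite -lt0n subn_gt0 height_min // /B; lia.
rewrite (chained_balanced w0u) mul1r subnn expr0 mul1r.
apply/prodf_neq0 => a _; apply/prodf_neq0 => b ab; rewrite /orient; case: ifP => _.
  by case: ifP; rewrite ?oppr_eq0 oner_neq0.
rewrite expr0n (_ : (_ == 0)%N = false) ?subr0 ?oner_neq0 //.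
by apply/negbTE; rewrite -lt0n subn_gt0 ltn_pmul2l // f_lt.
Qed.

(** The rescaled matrix is diagonal at s = 0, hence injective for some nonzero s; undoing the
    scalings gives a point of the curve where the entries are injective. *)
Lemma entries_nonsingular (T : finType) (w_ : T -> {ffun 'I_n -> 'I_m})
    (u_ : T -> {ffun 'I_n -> 'I_ell}) :
  injective w_ -> (forall t, chained (w_ t) (u_ t)) ->
  generically (fun z => forall d : T -> C,
    (forall t', \sum_t entry z (w_ t') (u_ t) * d t = 0) -> forall t, d t = 0).
Proof.
move=> w_inj wu.
apply: (generically_ker0 (L := fun t' z d => \sum_t entry z (w_ t') (u_ t) * d t)).
  by move=> t'; exists (fun t => entry_poly (w_ t') (u_ t)) => z d;
    apply: eq_bigr => t _; rewrite entry_polyE.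
pose cpoly t' t : {mpoly C[1]} := (balanced_blocks (w_ t') (u_ t))%:R *
  'X_ord0 ^+ (height B (w_ t') (u_ t) - height B (w_ t) (u_ t)) *
  \prod_(a < n) \prod_(b < n | (a < b)%N)
    (if clash (w_ t') (u_ t) a b then (orient (w_ t') a b)%:MP
     else 1 - 'X_ord0 ^+ (m * f a - m * f b)).
have cpolyE t' t y : (cpoly t' t).@[y] = curve_entry (y ord0) (w_ t) (w_ t') (u_ t).
  rewrite /cpoly /curve_entry !mevalM rmorph_nat rmorphXn /= mevalXU rmorph_prod; congr (_ * _).
  apply: eq_bigr => a _ /=; rewrite rmorph_prod; apply: eq_bigr => b _ /=.
  by case: ifP => _; rewrite ?mevalC // mevalB meval1 rmorphXn /= mevalXU.
have /generically_ex[y [yP /eqP y0]] : generically (fun y : 'I_1 -> C =>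
    (forall d : T -> C, (forall t', \sum_t curve_entry (y ord0) (w_ t) (w_ t') (u_ t) * d t = 0) ->
      forall t, d t = 0) /\ y ord0 <> 0).
  apply: generically_and.
    apply: (generically_ker0 (L := fun t' (y : 'I_1 -> C) d => 
      \sum_t curve_entry (y ord0) (w_ t) (w_ t') (u_ t) * d t)).
      by move=> t'; exists (cpoly t') => y d; apply: eq_bigr => t _; rewrite cpolyE.
    exists (fun=> 0) => d dP t; have := dP t.
    rewrite (bigD1 t) //= big1 ?addr0 => [/eqP|t' tt'].
      by rewrite mulf_eq0 -[curve_entry _ _ _ _ == 0]negbK curve_entry0 // eqxx => /eqP.
    have /eqP-> : curve_entry 0 (w_ t') (w_ t) (u_ t') == 0.
      by rewrite -[_ == _]negbK curve_entry0 // (inj_eq w_inj) eq_sym (negPf tt').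
    by rewrite mul0r.
  exists 'X_ord0; split; first by exists (fun=> 1); rewrite mevalXU oner_neq0.
  by move=> y; rewrite mevalXU => /eqP.
set s := y ord0 in yP y0; exists (curve s) => d dP t.
have sc0 : scale s != 0.
  by apply/prodf_neq0 => a _; apply/prodf_neq0 => b _; rewrite invr_neq0 ?expf_neq0.
(* The column factors are absorbed into [d]; the row factor multiplies the whole equation. *)
have := yP (fun t => scale s * s ^+ height B (w_ t) (u_ t) * d t).
suff H : forall t', \sum_t curve_entry s (w_ t) (w_ t') (u_ t) *
    (scale s * s ^+ height B (w_ t) (u_ t) * d t) = 0.
  move=> /(_ H t)/eqP; rewrite !mulf_eq0 (negPf sc0) expf_eq0 (negPf y0) andbF.
  by move/eqP.
move=> t'; transitivity (s ^+ cofactor (w_ t') * \sum_t entry (curve s) (w_ t') (u_ t) * d t).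
  rewrite big_distrr /=; apply: eq_bigr => k _.
  by rewrite [RHS]mulrA (entry_curve _ y0 (wu k)); ring.
by rewrite dP mulr0.
Qed.

End Entries.

(** * Spanning *)


(** An injective square matrix is surjective; [M] is the transpose, as vectors are rows. *)
Lemma nonsingular_solve (F : fieldType) (T : finType) (A : T -> T -> F) :
  (forall d : T -> F, (forall t', \sum_t A t' t * d t = 0) -> forall t, d t = 0) ->
  forall b : T -> F, exists d : T -> F, forall t', \sum_t A t' t * d t = b t'.
Proof.
move=> A_inj b; pose M : 'M[F]_#|T| := \matrix_(k, l) A (enum_val l) (enum_val k).
have mulM (d : 'rV[F]_#|T|) t' :
    (d *m M) 0 (enum_rank t') = \sum_t A t' t * d 0 (enum_rank t).
  rewrite mxE (reindex_onto enum_rank enum_val) /=; last by move=> i _; rewrite enum_valK.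
  under eq_bigl do rewrite enum_rankK eqxx.
  by apply: eq_bigr => t _; rewrite !mxE !enum_rankK mulrC.
have Mu : M \in unitmx.
  rewrite -row_free_unit -kermx_eq0; apply/eqP/row_matrixP => i; rewrite row0.
  have := mulmx_ker M => /(congr1 (row i)); rewrite row_mul row0.
  move: (row i _) => d dM; apply/rowP => k; rewrite [RHS]mxE -[k]enum_valK.
  by apply: (A_inj (fun t => d 0 (enum_rank t))) => t'; rewrite -mulM dM mxE.
exists (fun t => ((\row_k b (enum_val k)) *m invmx M) 0 (enum_rank t)) => t'.
by rewrite -mulM mulmxKV // mxE enum_rankK.
Qed.

(** * Conformal blocks in word coordinates *)

Section Coordinates.

Variables (C : numClosedFieldType) (m n : nat).
Implicit Types (z : 'I_n -> C) (p q : {mpoly C[m * n]}).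

Lemma mpoly_of_wordK c : wcoef (mpoly_of_word (@id 'I_n) c) = c :> ({ffun 'I_n -> 'I_m} -> C).
Proof.
apply: funext => w; rewrite wcoef_mpoly_of_word; congr (c _).
by apply/ffunP => a; rewrite ffunE.
Qed.

Lemma wcoef_iter_ez_op z i j k p : multilinear p ->
  wcoef (iter k (ez_op z i j) p) = iter k (opw z i j) (wcoef p).
Proof.
move=> /multilinearE {1}->; rewrite -[RHS]mpoly_of_wordK; congr wcoef.
by elim: k => //= k ->; rewrite ez_op_mpoly_of_word.
Qed.

Lemma iter_ez_op_linear z i j k x p q :
  iter k (ez_op z i j) (x *: p + q) = x *: iter k (ez_op z i j) p + iter k (ez_op z i j) q.
Proof. by elim: k => //= k ->; rewrite linearP. Qed.

Lemma CB_linear z ell (lam : m.-tuple nat) x p q :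
  CB z ell lam p -> CB z ell lam q -> CB z ell lam (x *: p + q).
Proof.
move=> [[mp ep dp] Dp] [[mq eq dq] Dq]; split; first split.
- by move=> mon /msuppD_le; rewrite mem_cat => /orP[/msuppZ_le/mp|/mq].
- by move=> i j ij; rewrite e_opE linearP /= -!e_opE ep // eq // scaler0 addr0.
- move=> i; rewrite e_opE linearP /= -!e_opE dp dq scalerDr !scalerA.
  by rewrite mulrC.
by move=> i j i0 jm; rewrite iter_ez_op_linear Dp // Dq // scaler0 addr0.
Qed.

Lemma CB0 z ell (lam : m.-tuple nat) : CB z ell lam 0.
Proof.
split; first split.
- by move=> mon; rewrite msupp0.
- by move=> i j _; rewrite e_opE linear0.
- by move=> i; rewrite e_opE linear0 scaler0.
by move=> i j _ _; rewrite (iter_derivation0 (@ez_op C m n z i j)).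
Qed.

Lemma CB_sum z ell (lam : m.-tuple nat) (I : Type) (r : seq I) (P : pred I) (c : I -> C) F :
  (forall i, P i -> CB z ell lam (F i)) -> CB z ell lam (\sum_(i <- r | P i) c i *: F i).
Proof.
move=> CBF; elim: r => [|i r IHr]; first by rewrite big_nil; apply: CB0.
by rewrite big_cons; case: ifP => // Pi; apply: CB_linear => //; apply: CBF.
Qed.

Lemma CB_block_system z ell (lam : m.-tuple nat) (i0 im : 'I_m) p :
  i0 = 0%N :> nat -> im = m.-1 :> nat ->
  CB z ell lam p -> block_system ell i0 im (tnth lam) z (wcoef p).
Proof.
move=> i00 imm [[mp ep dp] Dp]; have pE := multilinearE mp.
have e_coef i j : wcoef (e_op i j p) = opw (@one_z C n) i j (wcoef p).
  by rewrite e_opE (wcoef_iter_ez_op _ i j 1).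
split; last first.
  move=> v; have := Dp i0 im i00 imm => /(congr1 (@wcoef C m n)).
  rewrite wcoef_iter_ez_op // /level !(tnth_nth 0%N) i00 imm => /(congr1 (@^~ v)) /= ->.
  by rewrite /wcoef meval0.
split=> [w nz j|i j ij v]; last first.
  by rewrite -e_coef ep // /wcoef meval0.
have := congr1 (fun q => wcoef q w) (dp j); rewrite /= e_coef /wcoef mevalZ -/(wcoef p w).
rewrite /opw (eq_bigr (fun=> wcoef p w)) => [|a /eqP wa]; last first.
  by rewrite mul1r -[in upd w a j]wa upd_id.
rewrite sumr_const -[LHS]mulr_natl => /(mulIf nz)/eqP; rewrite eqr_nat => /eqP <-.
by rewrite cnt_card cardsE.
Qed.

End Coordinates.

Section Span.

Variables (C : numClosedFieldType) (m : nat) (lam : m.-tuple nat) (ell : nat).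
Hypotheses (m_gt1 : (1 < m)%N) (lam_sorted : sorted geq lam) (lam_spread : (spread lam <= ell)%N).
Let n := sumn lam.
Let m_gt0 : (0 < m)%N. Proof. exact: ltnW. Qed.
Let lt_pm : (m.-1 < m)%N. Proof. by rewrite prednK. Qed.
Let i0 : 'I_m := Ordinal m_gt0.
Let im : 'I_m := Ordinal lt_pm.

Lemma alcove_partition : alcove ell (tnth lam).
Proof.
apply/alcoveP => i j ij; rewrite !(tnth_nth 0%N).
have lt_im := ltn_ord i; have lt_jm := ltn_ord j.
have := @lam_le m lam lam_sorted i j; have := @lam_le m lam lam_sorted 0 i.
have := @lam_le m lam lam_sorted j m.-1; rewrite ij !ltn_ord lt_pm.
move: lam_spread; rewrite /spread (_ : (j <= m.-1)%N) ?ltn_predK //; last by rewrite -ltnS prednK.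
by move=> + /(_ isT) + /(_ isT) + /(_ isT); lia.
Qed.

Lemma admissible_blocks (w : {ffun 'I_n -> 'I_m}) (u : {ffun 'I_n -> 'I_ell}) :
  has_weight (tnth lam) w -> chained w u -> admissible lam (blocks u).
Proof.
move=> /has_weightP wt /chained_balanced/balanced_blocksP bb.
apply/andP; split; first exact: set_partition_blocks.
apply/forallP => j; apply/eqP; apply: (counts_of_content m_gt0) => // k.
rewrite -wt (cnt_bcnt w u); apply: eq_bigr => i _.
by rewrite bb card_blocks.
Qed.

Lemma CB_generic_span : generically (fun z : 'I_n -> C => injective z ->
  forall p, CB z ell lam p -> exists c : {ffun 'I_ell -> {set 'I_n}} -> C,
    p = \sum_(V : {ffun 'I_ell -> {set 'I_n}} | admissible lam V) c V *: Qfun m z V).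
Proof.
pose T : finType := {w : {ffun 'I_n -> 'I_m} | restricted ell w && has_weight (tnth lam) w}.
have /fin_all_exists[u wu] (t : T) : exists u, chained (ell := ell) (val t) u.
  by apply: exists_chained => //; case/andP: (valP t).
have i0_min (j : 'I_m) : (i0 <= j)%N by [].
have im_max (j : 'I_m) : (j <= im)%N by rewrite /= -ltnS prednK.
have lt0m : (i0 < im)%N by rewrite /= -ltnS prednK.
have sep := @separated_generic C m ell i0 im i0_min im_max lt0m n _ alcove_partition.
have := entries_nonsingular C m_gt1 val_inj wu.
move=> /(generically_and sep); apply: generically_imp => z [{}sep nonsing] z_inj p pCB.
(* The right-hand side carries [vand z] because the entries are cleared of denominators. *)
have [d dP] := nonsingular_solve nonsing (fun t => vand z * wcoef p (val t)).
have adm t : admissible lam (blocks (u t)).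
  by apply: admissible_blocks (wu t); case/andP: (valP t).
pose q := \sum_t d t *: Qfun m z (blocks (u t)).
have qCB : CB z ell lam q.
  by apply: CB_sum => t _; apply: CB_Qfun => //; apply: adm.
have pq : p = q.
  have pqCB : CB z ell lam (- 1 *: q + p) by apply: CB_linear.
  apply/eqP; rewrite -subr_eq0 addrC -scaleN1r; apply/eqP.
  have [[pq_ml _ _] _] := pqCB; rewrite (multilinearE pq_ml).
  rewrite (_ : wcoef _ = fun=> 0) ?mpoly_of_word0 //; apply: funext.
  apply: sep; split; first exact: CB_block_system.
  move=> w wr /has_weightP wt; pose t : T := Sub w (introT andP (conj wr wt)).
  have qw : wcoef q w = \sum_k d k * wcoef (Qfun m z (blocks (u k))) w.
    by rewrite /wcoef raddf_sum; apply: eq_bigr => k _; rewrite /= mevalZ.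
  apply: (mulfI (vand_neq0 z_inj)); rewrite mulr0 /wcoef mevalD mevalZ mulN1r.
  rewrite -/(wcoef q w) -/(wcoef p w) mulrDr mulrN qw -(dP t) big_distrr /= addrC.
  apply/eqP; rewrite subr_eq0; apply/eqP; apply: eq_bigr => k _.
  by rewrite -wcoef_Qfun //; ring.
(* The coefficient of [V] collects all words with blocks [V]; it is an empty sum if there are
   none. *)
exists (fun V => \sum_(t | blocks (u t) == V) d t).
rewrite pq /q (partition_big (fun t => blocks (u t)) (admissible lam)) //=.
apply: eq_bigr => V _; rewrite scaler_suml; apply: eq_bigr => t /eqP <- //.
Qed.

End Span.

Theorem mainTheorem4 (R : realType) (m : nat) (hm : (2 <= m)%N)
    (lam : m.-tuple nat) (hlam : sorted geq lam)
    (ell : nat) (hell : (0 < ell)%N) (hd : (spread lam <= ell)%N) :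
  exists O : ('I_(sumn lam) -> R[i]) -> Prop,
    [/\ zariski_open O,
        exists z, O z
      & forall z : 'I_(sumn lam) -> R[i], injective z -> O z ->
        forall p : {mpoly R[i][m * sumn lam]},
          CB z ell lam p <->
          exists c : {ffun 'I_ell -> {set 'I_(sumn lam)}} -> R[i],
            p = \sum_(U : {ffun 'I_ell -> {set 'I_(sumn lam)}} |
                       admissible lam U) c U *: Qfun m z U].
Proof.
have [f [f_neq0 fP]] := @CB_generic_span R[i] m lam ell hm hlam hd.
exists (fun z => f.@[z] != 0); split=> //.
  exists (fun g => g = f) => z; split=> [fz|[g -> //]]; by exists f.
move=> z z_inj fz p; split=> [/(fP z fz z_inj)//|[c ->]].
by apply: CB_sum => V; apply: CB_Qfun => //; apply: ltnW.
Qed.
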